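(* Let $Q,N\ge 1$, let $\varepsilon>0$, and let $(a_n)_{n\in\mathbb{Z}[i]}$ be any sequence of complex numbers. Then $$ \sum\limits_{\substack{q\in \mathbb{Z}[i]\setminus\{0\}\\ \mathcal{N}(q)\le Q^2\\ \mathcal{N}(q)\text{ is a perfect square}}} \sum\limits_{\substack{r \bmod{q}\\ (r,q)=1}} \left|\sum\limits_{\substack{n\in \mathbb{Z}[i]\\ \mathcal{N}(n)\le N}} a_n \cdot e\left(\mathrm{Tr}\left(\frac{nr}{2q}\right)\right)\right|^2 \ll (QN)^{\varepsilon}\left(Q^3+Q^2\sqrt{N}+\sqrt{Q}N\right)\sum\limits_{\substack{n\in \mathbb{Z}[i]\\ \mathcal{N}(n)\le N}} |a_n|^2, $$ where the implied constant depends only on $\varepsilon$.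
   Context: $\mathbb{Z}[i]$ is the ring of Gaussian integers. For $x\in\mathbb{Z}[i]$ (or $\mathbb{Q}(i)$), $\mathcal{N}(x)=x\overline{x}=(\Re x)^2+(\Im x)^2$ is the norm and $\mathrm{Tr}(x)=x+\overline{x}=2\Re x$ the trace. $e(z)=\exp(2\pi i z)$. For each $q$, the inner sum over $r$ runs over a reduced residue system modulo $q$ in $\mathbb{Z}[i]$, i.e. over residue classes $r$ mod $q$ with $r$ coprime to $q$ in $\mathbb{Z}[i]$. *)

(* Defs.v *)
From HB Require Import structures.
From mathcomp Require Import all_boot all_order all_algebra.
From mathcomp Require Import ring.
From mathcomp Require Import all_classical all_reals all_analysis.
From mathcomp Require Import complex.

Set Implicit Arguments.
Unset Strict Implicit.
Unset Printing Implicit Defensive.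

Import Order.TTheory GRing.Theory Num.Theory.

Local Open Scope classical_set_scope.
Local Open Scope ring_scope.
Local Open Scope complex_scope.

Record gaussInt : Type := GaussInt { gauss_re : int ; gauss_im : int }.

Definition pair_of_gauss (x : gaussInt) : int * int := (gauss_re x, gauss_im x).
Definition gauss_of_pair (p : int * int) : gaussInt := GaussInt p.1 p.2.

Lemma pair_of_gaussK : cancel pair_of_gauss gauss_of_pair.
Proof. by case. Qed.

HB.instance Definition _ := Countable.copy gaussInt (can_type pair_of_gaussK).

Definition gauss_add (x y : gaussInt) :=
  GaussInt (gauss_re x + gauss_re y) (gauss_im x + gauss_im y).
Definition gauss_opp (x : gaussInt) := GaussInt (- gauss_re x) (- gauss_im x).
Definition gauss_mul (x y : gaussInt) :=
  GaussInt (gauss_re x * gauss_re y - gauss_im x * gauss_im y)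
           (gauss_re x * gauss_im y + gauss_im x * gauss_re y).

Lemma gauss_addA : associative gauss_add.
Proof. by move=> [a b] [c d] [e f]; congr GaussInt; rewrite /= addrA. Qed.

Lemma gauss_addC : commutative gauss_add.
Proof. by move=> [a b] [c d]; congr GaussInt; rewrite /= addrC. Qed.

Lemma gauss_add0 : left_id (GaussInt 0 0) gauss_add.
Proof. by move=> [a b]; congr GaussInt; rewrite /= add0r. Qed.

Lemma gauss_addN : left_inverse (GaussInt 0 0) gauss_opp gauss_add.
Proof. by move=> [a b]; congr GaussInt; rewrite /= addNr. Qed.

HB.instance Definition _ :=
  GRing.isZmodule.Build gaussInt gauss_addA gauss_addC gauss_add0 gauss_addN.

Lemma gauss_mulA : associative gauss_mul.
Proof. by move=> [a b] [c d] [e f]; congr GaussInt; rewrite /=; ring. Qed.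

Lemma gauss_mulC : commutative gauss_mul.
Proof. by move=> [a b] [c d]; congr GaussInt; rewrite /=; ring. Qed.

Lemma gauss_mul1 : left_id (GaussInt 1 0) gauss_mul.
Proof. by move=> [a b]; congr GaussInt; rewrite /=; ring. Qed.

Lemma gauss_mulDl : left_distributive gauss_mul gauss_add.
Proof. by move=> [a b] [c d] [e f]; congr GaussInt; rewrite /=; ring. Qed.

Lemma gauss_one_neq0 : GaussInt 1 0 != 0.
Proof. by []. Qed.

HB.instance Definition _ := GRing.Zmodule_isComNzRing.Build gaussInt
  gauss_mulA gauss_mulC gauss_mul1 gauss_mulDl gauss_one_neq0.

Definition gauss_conj (x : gaussInt) : gaussInt :=
  GaussInt (gauss_re x) (- gauss_im x).
Definition gauss_norm (x : gaussInt) : int := gauss_re x ^+ 2 + gauss_im x ^+ 2.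

Lemma mul_gauss_conj (x : gaussInt) :
  x * gauss_conj x = GaussInt (gauss_norm x) 0.
Proof. by case: x => a b; congr GaussInt; rewrite /gauss_norm /=; ring. Qed.

Lemma gauss_normM (x y : gaussInt) :
  gauss_norm (x * y) = gauss_norm x * gauss_norm y.
Proof. by case: x y => [a b] [c d]; rewrite /gauss_norm /=; ring. Qed.

Definition gauss_dvd (d x : gaussInt) : Prop := exists k : gaussInt, x = k * d.

Definition gauss_unit (u : gaussInt) : Prop := gauss_dvd u 1.

Definition gauss_coprime (x y : gaussInt) : Prop :=
  forall d : gaussInt, gauss_dvd d x -> gauss_dvd d y -> gauss_unit d.

Definition gauss_cong (q x y : gaussInt) : Prop := gauss_dvd q (x - y).

Definition reduced_residue_system (q : gaussInt) (S : set gaussInt) : Prop :=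
  (forall r, S r -> gauss_coprime r q) /\
  (forall x, gauss_coprime x q -> exists! r, S r /\ gauss_cong q x r).

Lemma gauss_cong_refl (q x : gaussInt) : gauss_cong q x x.
Proof. by exists 0; rewrite subrr mul0r. Qed.

Lemma gauss_cong_sym (q x y : gaussInt) : gauss_cong q x y -> gauss_cong q y x.
Proof. by move=> [k e]; exists (- k); rewrite mulNr -e opprB. Qed.

Lemma gauss_cong_trans (q x y z : gaussInt) :
  gauss_cong q x y -> gauss_cong q y z -> gauss_cong q x z.
Proof.
move=> [k e] [l f]; exists (k + l).
by rewrite mulrDl -e -f addrA subrK.
Qed.

Lemma gauss_cong_coprime (q x y : gaussInt) :
  gauss_cong q x y -> gauss_coprime x q -> gauss_coprime y q.
Proof.
move=> [k e] cx d [u yE] [v qE]; apply: cx; last by exists v.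
exists (k * v + u); rewrite mulrDl -mulrA -qE -yE -e.
by rewrite subrK.
Qed.

Lemma reduced_residue_system_exists (q : gaussInt) :
  exists S : set gaussInt, reduced_residue_system q S.
Proof.
pose rep x := xget 0 [set y | gauss_cong q x y].
have repP x : gauss_cong q x (rep x).
  by apply: (@xgetPex _ 0 [set y | gauss_cong q x y]); exists x;
    exact: gauss_cong_refl.
have repE x y : gauss_cong q x y -> rep x = rep y.
  move=> xy; apply: (congr1 (xget 0)); apply/seteqP; split=> z /= h.
    exact: gauss_cong_trans (gauss_cong_sym xy) h.
  exact: gauss_cong_trans xy h.
exists [set r | gauss_coprime r q /\ rep r = r]; split=> [r []//|x cx].
exists (rep x); split.
  split; last exact: repP.
  by split; [exact: gauss_cong_coprime (repP x) cx | rewrite -(repE _ _ (repP x))].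
by move=> r [[_ rE] xr]; rewrite -rE; exact: repE.
Qed.

Section Complex.
Variable R : realType.

Definition gaussC (x : gaussInt) : R[i] := (gauss_re x)%:~R +i* (gauss_im x)%:~R.

Lemma gaussC_is_zmod_morphism : zmod_morphism gaussC.
Proof.
by move=> x y; rewrite /gaussC /= !rmorphB.
Qed.

Lemma gaussC_is_monoid_morphism : monoid_morphism gaussC.
Proof.
split=> // x y.
by rewrite /gaussC /= !rmorphD !rmorphN !rmorphM.
Qed.

HB.instance Definition _ :=
  GRing.isZmodMorphism.Build gaussInt R[i] gaussC gaussC_is_zmod_morphism.
HB.instance Definition _ :=
  GRing.isMonoidMorphism.Build gaussInt R[i] gaussC gaussC_is_monoid_morphism.

Definition cTr (z : R[i]) : R[i] := z + z^*.

(* The complex exponential: exp (x + i y) = exp x (cos y + i sin y). *)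
Definition cexp (z : R[i]) : R[i] :=
  (expR (complex.Re z))%:C * (cos (complex.Im z) +i* sin (complex.Im z)).

Definition eC (z : R[i]) : R[i] := cexp ((2 * pi)%:C * 'i%C * z).

(* The modulus of z as an element of R; `|z| has values in R[i]. *)
Definition cabs (z : R[i]) : R := ComplexField.Normc.normc z.

End Complex.

(* Main.v *)
(** Every Gaussian [q] of square norm satisfies [2 q = m z^2] with [m] a natural
    number.  By duality the left-hand side is at most [J^2 max_c P(c) sum |a_n|^2],
    where [J] has the order of [sqrt N + Q] and [P(c)] counts the moduli [q] having
    a reduced fraction [r / q] in the cell [c] of side [1 / J].  Let
    [eta = 2 Q / J] and let [beta] be a corner of the cell, so that
    [|beta q - r| <= eta].

    For a fixed [m], differences of the points [(z^2, r)] lie in a body of the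
    Z[i]-lattice Z[i]^2 and factor as [(z - z') (z + z')], so the divisor bound
    reduces the square of the count to a number of lattice points.  Either these
    points span the lattice, and there are [O((Q eta / m)^2)] of them, or all
    fractions [r / q] coincide.  Hence [O(Q^eps (1 + Q eta / m))] values of [z].

    For a fixed [z], the real and imaginary parts of [r / m] are rational numbers
    with controlled denominators, and the spacing of Farey fractions gives
    [O(Q^eps (1 + M eta))] values of [m] in [[M, 2 M[].

    Using the first bound for [m <= sqrt Q] and the second one for larger [m], the
    number of [q] in a cell is [O(Q^eps (sqrt Q + Q eta))]. *)

Require Import Defs.
From HB Require Import structures.
From mathcomp Require Import all_boot all_order all_algebra.
From mathcomp Require Import ring lra zify.
From mathcomp Require Import all_classical all_reals all_analysis.
From mathcomp Require Import complex.

Set Implicit Arguments.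
Unset Strict Implicit.
Unset Printing Implicit Defensive.

Import Order.TTheory GRing.Theory Num.Theory.

Local Open Scope classical_set_scope.
Local Open Scope ring_scope.

(** * Counting finite sequences *)

(** [J] exceeds [sqrt N] by a multiple of [Q] for the sake of [eta]. Once [eta <= 1/8], two
    numerators of the same [q] that lie near [beta q] differ by less than 1 in modulus and coincide,
    so a cell may be counted by its moduli alone. The bound [eta < 1] also keeps a lattice vector
    [(0, r)] with [r != 0] out of the body.

    Squares [z^2] are sparse: counting all lattice points of the body gives [(Q eta / m)^2], the
    square of what is wanted. Pairs of squares have just this order of magnitude, hence the detour
    through differences.

    The cut at [sqrt Q] balances the two bounds. For [m] of size [2^j] they are
    [2^j (1 + Q eta / 2^j)] and [(Q / 2^j) (1 + 2^j eta)], up to powers [Q^eps]; the terms with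
    [eta] agree, and only [2^j] and [Q / 2^j] compete. Finally [J^2 (sqrt Q + Q eta) = J^2 sqrt Q +
    2 Q^2 J], and [J] of order [sqrt N + Q] yields [sqrt Q N], [Q^2 sqrt N] and [Q^3]; the remaining
    [Q^2 sqrt Q] is absorbed by [Q^3]. *)

Lemma size_fibers (R : numDomainType) (T U : eqType) (f : T -> U) (s : seq T)
    (A B : R) :
  0 <= B -> (size (undup (map f s)))%:R <= A ->
  (forall y, (size [seq x <- s | f x == y])%:R <= B) ->
  (size s)%:R <= A * B.
Proof.
move=> B0 hA hB.
have -> : (size s)%:R =
    \sum_(y <- undup (map f s)) (size [seq x <- s | f x == y])%:R :> R.
  transitivity (\sum_(y <- undup (map f s)) \sum_(x <- s | f x == y) (1 : R)).
    rewrite -sum1_size natr_sum (exchange_big_dep xpredT) //=; apply: eq_big_seq => x xs.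
    rewrite (eq_bigl (fun y => y == f x)); last by move=> y; rewrite eq_sym.
    by rewrite -big_filter filter_pred1_uniq ?undup_uniq ?mem_undup ?map_f// big_seq1.
  by apply: eq_bigr => y _; rewrite size_filter -sum1_count natr_sum.
apply: (@le_trans _ _ (\sum_(y <- undup (map f s)) B)).
  by apply: ler_sum => y _; exact: hB.
by rewrite big_const_seq count_predT iter_addr_0 -[B *+ _]mulr_natl ler_wpM2r.
Qed.

Lemma size_inj (T U : eqType) (f : T -> U) (s : seq T) :
  uniq s -> {in s &, injective f} -> size s = size (undup (map f s)).
Proof. by move=> us fi; rewrite undup_id ?size_map// map_inj_in_uniq. Qed.

Lemma size_int_interval (R : realType) (s : seq int) (lo h : R) : 0 <= h ->
  uniq s -> (forall x, x \in s -> lo <= x%:~R <= lo + h) ->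
  (size s)%:R <= h + 1.
Proof.
move=> h0 us hs.
pose g (x : int) : nat := absz (x - Num.ceil lo).
have gE x : x \in s -> (g x)%:Z = x - Num.ceil lo.
  move=> /hs /andP[xlo _]; rewrite /g; apply: gez0_abs.
  by rewrite subr_ge0 ceil_le_int.
have gi : {in s &, injective g}.
  by move=> x y xs ys /(congr1 Posz); rewrite !gE// => /(addIr _).
have : (size s <= size (iota 0 (Num.truncn h).+1))%N.
  rewrite -(size_map g); apply: uniq_leq_size; first by rewrite map_inj_in_uniq.
  move=> _ /mapP[x xs ->]; rewrite mem_iota add0n ltnS /=.
  rewrite truncn_ge_nat//.
  rewrite -[(g x)%:R]/((g x)%:Z%:~R) gE// intrB.
  move: (hs x xs) => /andP[_ hx].
  have := ceil_ge lo; lra.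
rewrite size_iota => hsz.
apply: (@le_trans _ _ ((Num.truncn h).+1)%:R); first by rewrite ler_nat.
by rewrite -addn1 natrD lerD2r truncn_le.
Qed.

Lemma size_gauss_box (R : realType) (s : seq gaussInt) (B : R) : 0 <= B ->
  uniq s ->
  (forall x, x \in s -> `|(gauss_re x)%:~R| <= B /\ `|(gauss_im x)%:~R| <= B) ->
  (size s)%:R <= (2 * B + 1) ^+ 2.
Proof.
move=> B0 us hs; rewrite expr2.
apply: (size_fibers (f := gauss_re)); first lra.
  apply: (size_int_interval (lo := - B)); rewrite ?undup_uniq//; first lra.
  move=> x; rewrite mem_undup => /mapP[y /hs[+ _] ->]; rewrite ler_norml.
  by move=> /andP[h1 h2]; apply/andP; split; lra.
move=> a; rewrite (size_inj (f := gauss_im)) ?filter_uniq//; last first.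
  by move=> [x1 y1] [x2 y2]; rewrite !mem_filter /= => /andP[/eqP -> _] /andP[/eqP -> _] ->.
apply: (size_int_interval (lo := - B)); rewrite ?undup_uniq//; first lra.
move=> x; rewrite mem_undup => /mapP[y]; rewrite mem_filter => /andP[_ /hs[_ +]] ->.
by rewrite ler_norml => /andP[h1 h2]; apply/andP; split; lra.
Qed.

Lemma size_spaced (R : realType) (T : eqType) (f : T -> R) (s : seq T)
    (d lo h : R) : 0 < d -> 0 <= h -> uniq s ->
  (forall x y, x \in s -> y \in s -> x != y -> d <= `|f x - f y|) ->
  (forall x, x \in s -> lo <= f x <= lo + h) ->
  (size s)%:R <= h / d + 1.
Proof.
move=> d0 h0 us sep hs.
pose g x : int := Num.floor ((f x - lo) / d).
have gi : {in s &, injective g}.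
  move=> x y xs ys gxy; apply/eqP; apply: contraT => xy.
  have := sep x y xs ys xy; rewrite leNgt => /negP[].
  have h1 := Num.Theory.floor_le ((f x - lo) / d); have h2 := floorD1_gt ((f x - lo) / d).
  have h3 := Num.Theory.floor_le ((f y - lo) / d); have h4 := floorD1_gt ((f y - lo) / d).
  rewrite -/(g x) -/(g y) gxy !intrD in h1 h2 h3 h4.
  have : `|(f x - lo) / d - (f y - lo) / d| < 1.
    by rewrite ltr_norml; apply/andP; split; lra.
  rewrite -mulrBl normrM normfV (gtr0_norm d0) ltr_pdivrMr// mul1r.
  by rewrite (_ : f x - lo - (f y - lo) = f x - f y) //; ring.
rewrite (size_inj (f := g))//.
have q0 : 0 <= h / d by rewrite divr_ge0// ltW.
pose n := Num.floor (h / d).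
apply: (@le_trans _ _ (n%:~R + 1)); last by rewrite lerD2r; exact: Num.Theory.floor_le.
apply: (size_int_interval (lo := 0)); rewrite ?undup_uniq//.
  by rewrite ler0z floor_ge0.
move=> k; rewrite mem_undup => /mapP[x xs ->].
move: (hs x xs) => /andP[h1 h2]; rewrite add0r ler0z ler_int; apply/andP; split.
  by rewrite floor_ge0 divr_ge0 ?(ltW d0)// subr_ge0.
apply: le_floor; rewrite ler_pM2r ?invr_gt0//; lra.
Qed.

Lemma seq_argmin (R : realType) (T : eqType) (f : T -> R) (s : seq T) (x0 : T) :
  x0 \in s -> exists2 x, x \in s & forall y, y \in s -> f x <= f y.
Proof.
elim: s x0 => [//|a s IH] x0 _; case: s IH => [|b s] IH.
  by exists a; rewrite ?mem_head// => y; rewrite inE => /eqP ->.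
have [x xs hx] := IH b (mem_head _ _).
have [h|h] := leP (f a) (f x).
  exists a; rewrite ?mem_head// => y; rewrite inE => /predU1P[->//|/hx].
  exact: le_trans.
exists x; first by rewrite inE xs orbT.
by move=> y; rewrite inE => /predU1P[->|/hx//]; exact: ltW.
Qed.

(** * Arithmetic of the Gaussian integers *)

Lemma gauss_norm_ge0 (x : gaussInt) : 0 <= gauss_norm x.
Proof. by rewrite addr_ge0 ?sqr_ge0. Qed.

Lemma gauss_norm_eq0 (x : gaussInt) : (gauss_norm x == 0) = (x == 0).
Proof.
apply/eqP/eqP => [|->//]; case: x => a b; rewrite /gauss_norm /= => /eqP.
by rewrite paddr_eq0 ?sqr_ge0// !sqrf_eq0 => /andP[/eqP -> /eqP ->].
Qed.

Lemma gauss_norm_gt0 (x : gaussInt) : (0 < gauss_norm x) = (x != 0).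
Proof. by rewrite lt_neqAle gauss_norm_ge0 andbT eq_sym gauss_norm_eq0. Qed.

Lemma gauss_mul_eq0 (x y : gaussInt) : (x * y == 0) = (x == 0) || (y == 0).
Proof. by rewrite -(gauss_norm_eq0 (x * y)) gauss_normM mulf_eq0 !gauss_norm_eq0. Qed.

Lemma gauss_mulIf (x y z : gaussInt) : z != 0 -> x * z = y * z -> x = y.
Proof.
move=> z0 /eqP; rewrite -subr_eq0 -mulrBl gauss_mul_eq0 (negbTE z0) orbF.
by rewrite subr_eq0 => /eqP.
Qed.

Lemma gauss_sqr_eq (x y : gaussInt) : x ^+ 2 = y ^+ 2 -> x = y \/ x = - y.
Proof.
move=> /eqP; rewrite -subr_eq0 subr_sqr gauss_mul_eq0 subr_eq0 addr_eq0.
by case/orP => /eqP; [left|right].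
Qed.

Lemma gauss_natE (m : nat) : m%:R = GaussInt m%:Z 0 :> gaussInt.
Proof.
by elim: m => [//|m IH]; rewrite mulrS IH.
Qed.

Lemma gauss_norm_nat (m : nat) : gauss_norm m%:R = m%:Z ^+ 2.
Proof. by rewrite gauss_natE /gauss_norm /= expr0n addr0. Qed.

Lemma gauss_unitP (u : gaussInt) : gauss_unit u <-> gauss_norm u = 1.
Proof.
split=> [[k /(congr1 gauss_norm)]|u1].
  rewrite gauss_normM -[LHS]/(1 : int) => /esym h.
  have := gauss_norm_ge0 u; have := gauss_norm_ge0 k.
  move: (gauss_norm k) (gauss_norm u) h => [a|a] [b|b] //.
  by move=> /eqP; rewrite -PoszM eqz_nat muln_eq1 => /andP[_ /eqP ->].
by exists (gauss_conj u); rewrite mulrC mul_gauss_conj u1.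
Qed.

Lemma gauss_unit_expr4 (u : gaussInt) : gauss_unit u -> u ^+ 4 = 1.
Proof.
move=> /gauss_unitP; case: u => a b; rewrite /gauss_norm /= => h.
have : ((a == 1) || (a == -1)) && (b == 0) || ((b == 1) || (b == -1)) && (a == 0).
  by nia.
by move=> /orP[] /andP[/orP[]] /eqP -> /eqP ->.
Qed.

Lemma gauss_dvd_norm_le (d x : gaussInt) :
  x != 0 -> gauss_dvd d x -> gauss_norm d <= gauss_norm x.
Proof.
move=> x0 [k xE]; move: x0; rewrite -gauss_norm_gt0 xE gauss_normM.
have := gauss_norm_ge0 d; have := gauss_norm_ge0 k.
move: (gauss_norm k) (gauss_norm d) => [a|a] [b|b] // _ _.
by rewrite -PoszM ltz_nat muln_gt0 => /andP[a0 _]; rewrite lez_nat leq_pmull.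
Qed.

Lemma nearest_multiple (x n : int) : 0 < n ->
  exists k : int, - n <= 2 * (x - k * n) <= n.
Proof.
move=> n0; exists ((2 * x + n) %/ (2 * n))%Z.
have := divz_eq (2 * x + n) (2 * n).
have := modz_ge0 (2 * x + n) (d := 2 * n) _.
have := ltz_pmod (2 * x + n) (d := 2 * n) _.
move: (_ %% _)%Z (_ %/ _)%Z => r k h1 h2 h3.
have {}h1 := h1 ltac:(lia); have {}h2 := h2 ltac:(lia).
by apply/andP; split; lia.
Qed.

(** Rounding both coordinates of [a / b = a conj(b) / N(b)] leaves a remainder of norm at most
    [N(b) / 2]. The computation is multiplied by [N(b)] to stay within the integers. *)
Lemma gauss_euclid (a b : gaussInt) : b != 0 ->
  exists k : gaussInt, gauss_norm (a - k * b) < gauss_norm b.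
Proof.
rewrite -gauss_norm_gt0 => n0.
have [k1 hk1] := nearest_multiple (gauss_re (a * gauss_conj b)) n0.
have [k2 hk2] := nearest_multiple (gauss_im (a * gauss_conj b)) n0.
exists (GaussInt k1 k2).
rewrite -(ltr_pM2r n0) {1}(_ : gauss_norm b = gauss_norm (gauss_conj b)); last first.
  by rewrite /gauss_norm /= sqrrN.
rewrite -gauss_normM mulrBl -mulrA mul_gauss_conj.
move: hk1 hk2 n0; move: (a * gauss_conj b) (gauss_norm b) => [u v] n /=.
move=> hk1 hk2 n0; rewrite /gauss_norm /=.
set d1 := u - k1 * n in hk1; set d2 := v - k2 * n in hk2.
rewrite (_ : _ ^+ 2 + _ ^+ 2 = d1 ^+ 2 + d2 ^+ 2); last by rewrite /d1 /d2; ring.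
have h1 : 4 * d1 ^+ 2 <= n ^+ 2 by nra.
have h2 : 4 * d2 ^+ 2 <= n ^+ 2 by nra.
nra.
Qed.

(** Euclidean descent in the ideal [I] generated by [a] and [b]: a nonzero element either leaves a
    smaller remainder in [I] or divides both generators, and is then a unit. *)
Lemma gauss_bezout (a b : gaussInt) : gauss_coprime a b ->
  exists x y : gaussInt, x * a + y * b = 1.
Proof.
move=> cab.
pose I (g : gaussInt) := exists x y, g = x * a + y * b.
have Isub g h k : I g -> I h -> I (g - k * h).
  by move=> [x [y ->]] [x' [y' ->]]; exists (x - k * x'), (y - k * y'); ring.
have Ia : I a by exists 1, 0; ring.
have Ib : I b by exists 0, 1; ring.
have main n (g : gaussInt) : (`|gauss_norm g| <= n)%N -> g != 0 -> I g -> I 1.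
  elim: n g => [|n IH] g.
    by rewrite leqn0 absz_eq0 gauss_norm_eq0 => /eqP ->; rewrite eqxx.
  move=> gn g0 Ig.
  have red h : I h -> I 1 \/ gauss_dvd g h.
    move=> Ih; have [k hk] := gauss_euclid h g0.
    have [e|ne] := eqVneq (h - k * g) 0.
      by right; exists k; apply/eqP; rewrite -subr_eq0 e.
    left; apply: (IH (h - k * g)) => //; last exact: Isub.
    by move: hk (gauss_norm_ge0 (h - k * g)) gn; move: (gauss_norm g) (gauss_norm _); lia.
  have [//|da] := red a Ia; have [//|db] := red b Ib.
  have [k ->] := cab g da db.
  have := Isub 0 g (- k); rewrite sub0r mulNr opprK; apply => //.
  by exists 0, 0; ring.
have [a0|a0] := eqVneq a 0; last first.
  by have [x [y e]] := main _ a (leqnn _) a0 Ia; exists x, y.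
have [b0|b0] := eqVneq b 0; last first.
  by have [x [y e]] := main _ b (leqnn _) b0 Ib; exists x, y.
(* For [a = b = 0], coprimality would make the common divisor 0 a unit. *)
have [||k e] := cab 0; first by exists 1; rewrite a0 mulr0.
  by exists 1; rewrite b0 mulr0.
by move: e; rewrite mulr0.
Qed.

Lemma gauss_coprime_dvd_mul (d a b : gaussInt) :
  gauss_coprime d a -> gauss_dvd d (a * b) -> gauss_dvd d b.
Proof.
move=> /gauss_bezout[x [y e]] [k ke]; exists (x * b + y * k).
by rewrite -[LHS]mul1r -e mulrDl -[y * a * b]mulrA ke; ring.
Qed.

Lemma gauss_coprime_sym (x y : gaussInt) : gauss_coprime x y -> gauss_coprime y x.
Proof. by move=> h d d1 d2; apply: h. Qed.

(** * Gaussian primes and the divisor bound *)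

Definition gauss_prime (p : gaussInt) : Prop :=
  [/\ p != 0, ~ gauss_unit p &
      forall d, gauss_dvd d p -> gauss_unit d \/ gauss_dvd p d].

Lemma gauss_norm_nonunit (u : gaussInt) : u != 0 -> ~ gauss_unit u ->
  2 <= gauss_norm u.
Proof.
rewrite -gauss_norm_gt0 => u0 /gauss_unitP u1.
by have : gauss_norm u != 1 by [apply/eqP]; move: u0; move: (gauss_norm u); lia.
Qed.

Lemma gauss_prime_dvd_ex (w : gaussInt) : w != 0 -> ~ gauss_unit w ->
  exists2 p, gauss_prime p & gauss_dvd p w.
Proof.
have [n] := ubnP `|gauss_norm w|; elim: n w => // n IH w wn w0 wu.

have [hd|] := pselect (forall d, gauss_dvd d w -> gauss_unit d \/ gauss_dvd w d).
  by exists w; [split|exists 1; rewrite mul1r].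
move=> /existsNP[d /not_implyP[dw /not_orP[du wd]]].
have [k kE] := dw.
have d0 : d != 0 by apply: contraNneq w0 => d0; rewrite kE d0 mulr0.
have k0 : k != 0 by apply: contraNneq w0 => k0; rewrite kE k0 mul0r.
have ku : ~ gauss_unit k.
  by move=> [u ue]; apply: wd; exists u; rewrite kE mulrA -ue mul1r.
have nk := gauss_norm_nonunit k0 ku.
have [|p pp [l pd]] := IH d _ d0 du.
  move: wn; rewrite kE gauss_normM; move: d0; rewrite -gauss_norm_gt0.
  by move: (gauss_norm d) (gauss_norm k) nk => a b; nia.
by exists p => //; exists (k * l); rewrite kE pd mulrA.
Qed.

Lemma gauss_prime_coprime (p d : gaussInt) :
  gauss_prime p -> ~ gauss_dvd p d -> gauss_coprime d p.
Proof.
move=> [_ _ hp] pd g [k gd] /hp[//|[l gp]].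
by case: pd; exists (k * l); rewrite gd gp mulrA.
Qed.

(* the prime-to-[p] divisors of [p^k w] divide [w] *)
Lemma size_divisors_prime_power (R : realType) (p w : gaussInt) (k : nat) (B : R) :
  gauss_prime p ->
  (forall s, uniq s -> (forall d, d \in s -> gauss_dvd d w) -> (size s)%:R <= B) ->
  forall s, uniq s -> (forall d, d \in s -> gauss_dvd d (p ^+ k * w)) ->
    (size s)%:R <= k.+1%:R * B.
Proof.
move=> pp hw; have [p0 _ _] := pp.
have cop j d : ~ gauss_dvd p d -> gauss_dvd d (p ^+ j * w) -> gauss_dvd d w.
  elim: j => [|j IH] pd; first by rewrite expr0 mul1r.
  rewrite exprS -mulrA => /gauss_coprime_dvd_mul h; apply: IH => //; apply: h.
  exact: gauss_prime_coprime.
elim: k => [|k IH] s us hs.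
  by rewrite mul1r; apply: hw => // d /hs; rewrite expr0 mul1r.
pose c d := `[< gauss_dvd p d >].
rewrite -(count_predC c) natrD -addn1 natrD mulrDl mul1r; apply: lerD.
  pose g d := xget 0 [set e | d = e * p].
  have gE d : c d -> d = g d * p.
    by move=> /asboolP[e de]; have := @xgetPex _ 0 [set e | d = e * p]; apply; exists e.
  rewrite -size_filter (size_inj (f := g)) ?filter_uniq//; last first.
    move=> x y; rewrite !mem_filter => /andP[/gE xE _] /andP[/gE yE _] e.
    by rewrite xE yE e.
  apply: IH; rewrite ?undup_uniq// => d; rewrite mem_undup => /mapP[e].
  rewrite mem_filter => /andP[/gE eE /hs[l le]] ->; exists l.
  by apply: (gauss_mulIf p0); rewrite -[l * _ * _]mulrA -eE -le exprS; ring.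
rewrite -size_filter; apply: hw; rewrite ?filter_uniq// => d.
rewrite mem_filter /= => /andP[/asboolPn pd /hs]; exact: cop.
Qed.

(** Bernoulli's inequality. It absorbs the exponents of small primes in the divisor bound, and later
    the number of dyadic blocks, into an arbitrarily small power. *)
Lemma natS_le_expr (R : realType) (c : R) : 1 < c ->
  exists2 K : R, 0 < K & forall k : nat, k.+1%:R <= K * c ^+ k.
Proof.
move=> c1; have x0 : 0 < c - 1 by rewrite subr_gt0.
have bern k : 1 + k%:R * (c - 1) <= c ^+ k.
  elim: k => [|k IH]; first by rewrite mul0r addr0 expr0.
  have c0 : 0 <= c by lra.
  rewrite exprS -natr1; apply: le_trans (ler_wpM2l c0 IH).
  have := mulr_ge0 (ler0n R k) (sqr_ge0 (c - 1)); lra.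
exists (1 + (c - 1)^-1); first by rewrite addr_gt0 ?invr_gt0.
move=> k; apply: (@le_trans _ _ ((1 + (c - 1)^-1) * (1 + k%:R * (c - 1)))); last first.
  by rewrite ler_wpM2l// addr_ge0// invr_ge0 ltW.
have -> : (1 + (c - 1)^-1) * (1 + k%:R * (c - 1)) =
    k.+1%:R + (c - 1)^-1 + k%:R * (c - 1).
  by rewrite -natr1; field; rewrite gt_eqF.
have := ler0n R k; have : 0 < (c - 1)^-1 by rewrite invr_gt0.
nra.
Qed.

Definition gauss_box (n : nat) : seq gaussInt :=
  let l := [seq k%:Z - n%:Z | k <- iota 0 (n + n).+1] in
  [seq GaussInt x y | x <- l, y <- l].

Lemma mem_gauss_box (n : nat) (x : gaussInt) :
  `|gauss_re x| <= n -> `|gauss_im x| <= n -> x \in gauss_box n.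
Proof.
have aux (k : int) : `|k| <= n -> k \in [seq k%:Z - n%:Z | k <- iota 0 (n + n).+1].
  move=> kn; apply/mapP; exists (absz (k + n%:Z)); first by rewrite mem_iota; lia.
  by rewrite gez0_abs; lia.
by case: x => a b /= /aux ha /aux hb; apply/allpairsP; exists (a, b).
Qed.

Lemma gauss_norm_box (x : gaussInt) (n : nat) :
  gauss_norm x <= n%:Z -> x \in gauss_box n.
Proof. by case: x => a b; rewrite /gauss_norm /= => h; apply: mem_gauss_box => /=; nia. Qed.

Lemma gauss_prime_part (p w : gaussInt) : gauss_prime p -> w != 0 ->
  exists k w', w = p ^+ k * w' /\ ~ gauss_dvd p w'.
Proof.
move=> pp; have [p0 pu _] := pp.
have [n] := ubnP `|gauss_norm w|; elim: n w => // n IH w wn w0.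
have [[v vE]|npw] := pselect (gauss_dvd p w); last first.
  by exists 0%N, w; rewrite expr0 mul1r.
have v0 : v != 0 by apply: contraNneq w0 => v0; rewrite vE v0 mul0r.
have [|k [w' [e h]]] := IH v _ v0.
  move: wn; rewrite vE gauss_normM; move: v0; rewrite -gauss_norm_gt0.
  have := gauss_norm_nonunit p0 pu.
  by move: (gauss_norm p) (gauss_norm v) => a b; nia.
by exists k.+1, w'; split => //; rewrite vE e exprS; ring.
Qed.

(** Divisors are counted with their associates. A prime with [N(p)^eps >= 2] at most doubles their
    number, and its factor [N(p)^eps] pays for that. The finitely many other primes cost a constant
    each, which is collected by induction on a list that contains them. *)
Lemma gauss_divisor_bound (R : realType) (eps : R) : 0 < eps ->
  exists2 C : R, 0 < C & forall (w : gaussInt) (s : seq gaussInt), w != 0 ->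
    uniq s -> (forall d, d \in s -> gauss_dvd d w) ->
    (size s)%:R <= C * (gauss_norm w)%:~R `^ eps.
Proof.
move=> e0.
pose small (p : gaussInt) := (gauss_norm p)%:~R `^ eps < 2 :> R.
have powM (x y : gaussInt) : (gauss_norm (x * y))%:~R `^ eps =
    (gauss_norm x)%:~R `^ eps * (gauss_norm y)%:~R `^ eps :> R.
  by rewrite gauss_normM intrM powRM// ler0z gauss_norm_ge0.
have claim (l : seq gaussInt) : exists2 C : R, 0 < C &
    forall (w : gaussInt), w != 0 ->
    (forall p, gauss_prime p -> gauss_dvd p w -> small p -> p \in l) ->
    forall s, uniq s -> (forall d, d \in s -> gauss_dvd d w) ->
    (size s)%:R <= C * (gauss_norm w)%:~R `^ eps.
  elim: l => [|a l [C C0 IH]].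
    (* With no small prime left, the constant only has to count the divisors of a unit: they have
       both coordinates in [{-1, 0, 1}]. *)
    exists 9 => // w; have [n] := ubnP `|gauss_norm w|; elim: n w => // n IH w wn w0 ws s us hs.
    have [wu|wu] := pselect (gauss_unit w).
      have w1 : gauss_norm w = 1 by apply/gauss_unitP.
      rewrite w1 powR1 mulr1.
      have := @size_gauss_box R s 1 ler01 us; rewrite (_ : (2 * 1 + 1) ^+ 2 = 9); last by ring.
      apply => d /hs /(gauss_dvd_norm_le w0); rewrite w1 {1}/gauss_norm => hd.
      rewrite -!intr_norm -[1]/(1%:~R) !ler_int.
      by move: (gauss_re d) (gauss_im d) hd => x y; split; nia.
    have [p pp pw] := gauss_prime_dvd_ex w0 wu.
    have [v vE] := pw; have [p0 pu _] := pp.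
    have v0 : v != 0 by apply: contraNneq w0 => v0; rewrite vE v0 mul0r.
    have {}IH : forall s, uniq s -> (forall d, d \in s -> gauss_dvd d v) ->
        (size s)%:R <= 9 * (gauss_norm v)%:~R `^ eps.
      apply: IH => // [|p' pp' [k p'v] sp'].
        move: wn; rewrite vE gauss_normM; move: v0; rewrite -gauss_norm_gt0.
        have := gauss_norm_nonunit p0 pu.
        by move: (gauss_norm p) (gauss_norm v) => a b; nia.
      by apply: ws => //; exists (k * p); rewrite vE p'v; ring.
    have : (size s)%:R <= 2%:R * (9 * (gauss_norm v)%:~R `^ eps : R).
      apply: (size_divisors_prime_power (k := 1) pp IH) => // d /hs.
      by rewrite vE expr1 mulrC.
    move=> /le_trans; apply; rewrite vE powM.
    have : 2 <= (gauss_norm p)%:~R `^ eps :> R.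
      by rewrite leNgt; apply/negP => /(ws p pp pw).
    have := powR_ge0 ((gauss_norm v)%:~R : R) eps; nra.
  (* The list will be a full box of Gaussian integers, so entries that are not prime are skipped. *)
  have [ap|nap] := pselect (gauss_prime a); last first.
    exists C => // w w0 ws; apply: IH => // p pp pw sp.
    have := ws p pp pw sp; rewrite inE => /predU1P[pa|//].
    by rewrite pa in pp.
  have [a0 au _] := ap.
  have c1 : 1 < (2 : R) `^ eps.
    have := @gt0_ltr_powR R eps e0 1 2; rewrite powR1.
    by apply; rewrite ?nnegrE// ltr1n.
  have [K K0 hK] := natS_le_expr c1.
  exists (K * C); first by rewrite mulr_gt0.
  move=> w w0 ws s us hs.
  have [k [v [vE av]]] := gauss_prime_part ap w0.
  have v0 : v != 0 by apply: contraNneq w0 => v0; rewrite vE v0 mulr0.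
  have {}IH : forall s, uniq s -> (forall d, d \in s -> gauss_dvd d v) ->
        (size s)%:R <= C * (gauss_norm v)%:~R `^ eps.
    apply: IH => // p pp [u uv] sp; have := ws p pp.
    rewrite inE => /(_ _ sp)/predU1P[|pa|//].
      by exists (p ^+ 0 * a ^+ k * u); rewrite vE uv; ring.
    by case: av; exists u; rewrite -pa.
  have := size_divisors_prime_power (k := k) ap IH us.
  rewrite -vE => /(_ hs)/le_trans; apply.
  have -> : (gauss_norm w)%:~R `^ eps =
     ((gauss_norm a)%:~R `^ eps) ^+ k * (gauss_norm v)%:~R `^ eps :> R.
    rewrite vE powM; congr (_ * _); elim: (k) => [|j IHj].
      by rewrite !expr0 powR1.
    by rewrite !exprS powM IHj.
  rewrite -[leRHS]mulrA [C * (_ * _)]mulrCA [leRHS]mulrA.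
  apply: ler_wpM2r; first by rewrite mulr_ge0 ?powR_ge0// ltW.
  apply: le_trans (hK k) _; rewrite ler_pM2l// lerXn2r ?nnegrE ?powR_ge0//.
  rewrite ge0_ler_powR ?nnegrE ?ler0z ?gauss_norm_ge0// ?(ltW e0)//.
  by rewrite -[2]/(2%:~R) ler_int gauss_norm_nonunit.
(* A prime of norm above [2^(1 / eps)] is not small, so all small primes lie in one box. *)
pose n := (Num.truncn (2 `^ eps^-1 : R)).+1.
have [C C0 hC] := claim (gauss_box n).
exists C => // w s w0; apply: hC => // p pp _ sp; apply: gauss_norm_box.
rewrite -(ler_int R) leNgt; apply/negP => pn; move: sp; rewrite /small ltNge => /negP; apply.
have h : 2 `^ eps^-1 <= (gauss_norm p)%:~R :> R.
  by apply: ltW; apply: lt_trans pn; exact: truncnS_gt.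
apply: (@le_trans _ _ ((2 `^ eps^-1) `^ eps)).
  by rewrite -powRrM mulVf ?powRr1// lt0r_neq0.
apply: ge0_ler_powR => //; first exact: ltW.
  by rewrite nnegrE powR_ge0.
by rewrite nnegrE ler0z gauss_norm_ge0.
Qed.

(** * Gaussian integers whose norm is a square *)

Lemma coprime_mul_sqr (x y b : nat) : coprime x y -> (x * y = b ^ 2)%N ->
  exists s, x = (s ^ 2)%N.
Proof.
move=> cxy e; have [x0|x0] := posnP x; first by exists 0%N.
(* Write [x = x' g] and [b = b' g] with [g = gcd(x, b)]. From [x' y = g b'^2] one gets [g = h x']
   and [y = h b'^2]; then [h] divides both [x] and [y], so [h = 1] and [x = x'^2]. *)
have g0 : (0 < gcdn x b)%N by rewrite gcdn_gt0 x0.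
have [x' xE] := dvdnP (dvdn_gcdl x b); have [b' bE] := dvdnP (dvdn_gcdr x b).
have cxb : coprime x' b'.
  by rewrite /coprime -(eqn_pmul2r g0) mul1n muln_gcdl -xE -bE.
move: (gcdn x b) g0 xE bE => g g0 xE bE.
have e1 : (x' * y = g * b' ^ 2)%N.
  by apply/eqP; rewrite -(eqn_pmul2r g0); apply/eqP; nia.
have : (x' %| g)%N.
  by rewrite -(Gauss_dvdl _ (m := x') (p := b' ^ 2)) ?coprimeXr// -e1 dvdn_mulr.
move=> /dvdnP[h gE].
have x'0 : (0 < x')%N by case: (posnP x') => // x'0; move: x0; rewrite xE x'0.
have yE : y = (h * b' ^ 2)%N.
  by apply/eqP; rewrite -(eqn_pmul2l x'0); apply/eqP; rewrite e1 gE; nia.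
have : (h %| gcdn x y)%N.
  by rewrite xE gE yE dvdn_gcd mulnCA !dvdn_mulr.
rewrite (eqP cxy) dvdn1 => /eqP h1; exists x'; rewrite xE gE h1; lia.
Qed.

(** This is the parametrization of Pythagorean triples. If [q = a + b i] has norm [c^2], then
    [(c + a) (c - a) = b^2]; dividing by [m = gcd(c + a, c - a)] leaves coprime squares [s^2] and
    [t^2], and [z = s + i t] or its conjugate, according to the sign of [b]. The factor 2 spares a
    distinction of parities. *)
Lemma square_norm_param (q : gaussInt) (k : int) : gauss_norm q = k ^+ 2 ->
  exists (m : nat) (z : gaussInt), 2 * q = m%:R * z ^+ 2.
Proof.
case: q => a b; rewrite /gauss_norm /= => kE.
have {kE}[c c0 kE] : exists2 c : int, 0 <= c & a ^+ 2 + b ^+ 2 = c ^+ 2.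
  by exists `|k| => //; rewrite kE real_normK// num_real.
have ac : `|a| <= c by nia.
pose x := absz (c + a); pose y := absz (c - a); pose d := absz b.
have xE : x%:Z = c + a by rewrite /x; lia.
have yE : y%:Z = c - a by rewrite /y; lia.
have xyd : (x * y = d ^ 2)%N.
  apply/eqP; rewrite -(eqr_nat int) !pmulrn; apply/eqP.
  rewrite PoszM xE yE -[(d ^ 2)%N]/(d * d)%N PoszM -expr2 /d.
  congr (_%:~R); rewrite abszE real_normK ?num_real//; lra.
have [|m0] := posnP (gcdn x y).
  move=> g0; have := dvdn_gcdr x y; have := dvdn_gcdl x y.
  rewrite g0 !dvd0n => /eqP x0 /eqP y0.
  (* The gcd vanishes only for [q = 0]. *)
  exists 0%N, 0; rewrite mul0r.
  have -> : a = 0 by lia.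
  have -> : b = 0 by rewrite x0 in xyd; move: xyd; rewrite /d; nia.
  by rewrite -[GaussInt 0 0]/(0 : gaussInt) mulr0.
have [x' x'E] := dvdnP (dvdn_gcdl x y); have [y' y'E] := dvdnP (dvdn_gcdr x y).
have cxy : coprime x' y'.
  by rewrite /coprime -(eqn_pmul2r m0) mul1n muln_gcdl -x'E -y'E.
move: (gcdn x y) m0 x'E y'E => m m0 x'E y'E.
have : (m ^ 2 %| d ^ 2)%N by rewrite -xyd x'E y'E; apply/dvdnP; exists (x' * y')%N; nia.
rewrite dvdn_pexp2r// => /dvdnP[d' dE].
have xyd' : (x' * y' = d' ^ 2)%N.
  apply/eqP; rewrite -(eqn_pmul2r (_ : 0 < m ^ 2)%N) ?expn_gt0 ?m0//; apply/eqP; nia.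
have [s sE] := coprime_mul_sqr cxy xyd'.
have [t tE] : exists t, y' = (t ^ 2)%N.
  by apply: (@coprime_mul_sqr y' x' d'); rewrite 1?coprime_sym// mulnC.
have d'E : d' = (s * t)%N.
  by apply/eqP; rewrite -eqn_sqr expnMn -sE -tE xyd'.
have x2 : c + a = m%:Z * s%:Z ^+ 2.
  by rewrite -xE x'E sE PoszM mulrC -mulnn PoszM expr2.
have y2 : c - a = m%:Z * t%:Z ^+ 2.
  by rewrite -yE y'E tE PoszM mulrC -mulnn PoszM expr2.
have d2 : `|b| = m%:Z * s%:Z * t%:Z.
  by rewrite -abszE -/d dE d'E !PoszM; ring.
have [b0|b0] := leP 0 b.
  rewrite ger0_norm// in d2.
  exists m, (GaussInt s t); rewrite !gauss_natE expr2 d2; congr GaussInt => /=; last by ring.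
  by move: x2 y2; rewrite !expr2; lra.
rewrite ltr0_norm// in d2; have {}d2 : b = - (m%:Z * s%:Z * t%:Z) by rewrite -d2 opprK.
exists m, (GaussInt s (- t%:Z)); rewrite !gauss_natE expr2 d2; congr GaussInt => /=; last by ring.
by move: x2 y2; rewrite !expr2; lra.
Qed.

(** * Moduli with a fixed multiplier *)

Section ComplexModulus.
Variable R : realType.
Implicit Types (x y z : R[i]) (g : gaussInt).

Lemma cabs_ge0 z : 0 <= cabs z.
Proof. by case: z => a b; exact: sqrtr_ge0. Qed.

Lemma cabsM x y : cabs (x * y) = cabs x * cabs y.
Proof. exact: ComplexField.Normc.normcM. Qed.

Lemma cabsV x : cabs x^-1 = (cabs x)^-1.
Proof. exact: ComplexField.Normc.normcV. Qed.

Lemma cabs1 : cabs (1 : R[i]) = 1.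
Proof. exact: ComplexField.Normc.normc1. Qed.

Lemma cabs0 : cabs (0 : R[i]) = 0.
Proof. exact: ComplexField.Normc.normc0. Qed.

Lemma cabsX x n : cabs (x ^+ n) = cabs x ^+ n.
Proof. by elim: n => [|n IH]; rewrite ?expr0 ?cabs1// !exprS cabsM IH. Qed.

Lemma cabs_eq0 z : (cabs z == 0) = (z == 0).
Proof.
apply/eqP/eqP => [|->]; last exact: cabs0.
exact: ComplexField.Normc.eq0_normc.
Qed.

Lemma cabs_gt0 z : (0 < cabs z) = (z != 0).
Proof. by rewrite lt_neqAle cabs_ge0 andbT eq_sym cabs_eq0. Qed.

Lemma cabsD x y : cabs (x + y) <= cabs x + cabs y.
Proof. exact: le_normcD. Qed.

Lemma cabsN x : cabs (- x) = cabs x.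
Proof. exact: normcN. Qed.

Lemma cabsB x y : cabs (x - y) <= cabs x + cabs y.
Proof. by rewrite -(cabsN y) cabsD. Qed.

Lemma cabs_sqr z : cabs z ^+ 2 = complex.Re z ^+ 2 + complex.Im z ^+ 2.
Proof. by case: z => a b; rewrite sqr_sqrtr// addr_ge0 ?sqr_ge0. Qed.

Lemma cabs_Re z : `|complex.Re z| <= cabs z.
Proof.
rewrite -(@ler_pXn2r _ 2)// ?nnegrE ?cabs_ge0// cabs_sqr real_normK ?num_real//.
by rewrite lerDl sqr_ge0.
Qed.

Lemma cabs_Im z : `|complex.Im z| <= cabs z.
Proof.
rewrite -(@ler_pXn2r _ 2)// ?nnegrE ?cabs_ge0// cabs_sqr real_normK ?num_real//.
by rewrite lerDr sqr_ge0.
Qed.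

Lemma cabs_real (a : R) : cabs (a%:C)%C = `|a|.
Proof. by rewrite /cabs /= expr0n addr0 sqrtr_sqr. Qed.

Lemma cabs_nat (n : nat) : cabs (n%:R : R[i]) = n%:R.
Proof. by rewrite -(rmorph_nat (real_complex R)) cabs_real ger0_norm ?ler0n. Qed.

Lemma cabs_gaussC g : cabs (gaussC R g) ^+ 2 = (gauss_norm g)%:~R.
Proof. by rewrite cabs_sqr /gaussC /gauss_norm /= intrD !rmorphXn. Qed.

Lemma gaussC_inj : injective (gaussC R).
Proof.
by move=> [a b] [c d] [/eqP + /eqP]; rewrite !eqr_int => /eqP -> /eqP ->.
Qed.

Lemma gaussCM g h : gaussC R (g * h) = gaussC R g * gaussC R h.
Proof. exact: rmorphM. Qed.

Lemma gaussCB g h : gaussC R (g - h) = gaussC R g - gaussC R h.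
Proof. exact: rmorphB. Qed.

Lemma gaussCX g n : gaussC R (g ^+ n) = gaussC R g ^+ n.
Proof. exact: rmorphXn. Qed.

Lemma gaussC_eq0 g : (gaussC R g == 0) = (g == 0).
Proof. by rewrite -(rmorph0 (gaussC R)) (inj_eq gaussC_inj). Qed.

Lemma cabs_gauss_ge1 g : g != 0 -> 1 <= cabs (gaussC R g).
Proof.
rewrite -gauss_norm_gt0 => g0.
rewrite -(@ler_pXn2r _ 2)// ?nnegrE ?cabs_ge0// cabs_gaussC expr1n.
by rewrite -[1]/(1%:~R) ler_int.
Qed.

Lemma cabs_gauss_lt1 g : cabs (gaussC R g) < 1 -> g = 0.
Proof.
by move=> h; apply/eqP; apply: contraTT h => /cabs_gauss_ge1; rewrite leNgt.
Qed.

Lemma cabs_gauss_Re g : `|(gauss_re g)%:~R| <= cabs (gaussC R g).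
Proof. exact: (cabs_Re (gaussC R g)). Qed.

Lemma cabs_gauss_Im g : `|(gauss_im g)%:~R| <= cabs (gaussC R g).
Proof. exact: (cabs_Im (gaussC R g)). Qed.

End ComplexModulus.

(** * Lattice points near a complex line *)

Lemma size_gauss_box2 (R : realType) (s : seq (gaussInt * gaussInt)) (B1 B2 : R) :
  0 <= B1 -> 0 <= B2 -> uniq s ->
  (forall p, p \in s ->
    [/\ `|(gauss_re p.1)%:~R| <= B1, `|(gauss_im p.1)%:~R| <= B1,
        `|(gauss_re p.2)%:~R| <= B2 & `|(gauss_im p.2)%:~R| <= B2]) ->
  (size s)%:R <= (2 * B1 + 1) ^+ 2 * (2 * B2 + 1) ^+ 2.
Proof.
move=> B10 B20 us hs; apply: (size_fibers (f := fst)); first by rewrite sqr_ge0.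
  apply: size_gauss_box => //; first exact: undup_uniq.
  by move=> x; rewrite mem_undup => /mapP[p /hs[h1 h2 _ _] ->].
move=> x; rewrite (size_inj (f := snd)) ?filter_uniq//; last first.
  by move=> [a b] [c d]; rewrite !mem_filter /= => /andP[/eqP -> _] /andP[/eqP -> _] ->.
apply: size_gauss_box => //; first exact: undup_uniq.
move=> y; rewrite mem_undup => /mapP[p].
by rewrite mem_filter => /andP[_ /hs[_ _ h1 h2]] ->.
Qed.

Lemma floor_eq_dist (R : realType) (a b : R) :
  Num.floor a = Num.floor b -> `|a - b| < 1.
Proof.
move=> e; have h1 := Num.Theory.floor_le a; have h2 := floorD1_gt a.
have h3 := Num.Theory.floor_le b; have h4 := floorD1_gt b.
by rewrite e !intrD in h1 h2; rewrite intrD in h4; rewrite ltr_norml; apply/andP; split; lra.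
Qed.

(* Minkowski-type dichotomy for the Z[i]-lattice of the pairs [(w, rho)]:
   with [p1] a shortest vector, of length [lam], the determinants against [p1]
   are bounded by [2 A eta lam], and on each line parallel to [p1] the points
   are 1-separated in the coordinate along [p1]. *)
Lemma lattice_dichotomy (R : realType) (alpha : R[i]) (A eta : R)
    (K := fun p : gaussInt * gaussInt => cabs (gaussC R p.1) <= A /\
       cabs (alpha * gaussC R p.1 - gaussC R p.2) <= eta) :
  0 < A -> 0 < eta -> eta < 1 ->
  (forall p p', K p -> K p' -> p.1 * p'.2 = p'.1 * p.2) \/
  (forall s, uniq s -> (forall p, p \in s -> K p) ->
     (size s)%:R <= (42 * (A * eta)) ^+ 2).
Proof.
move=> A0 eta0 eta1.
have [[p0 [Kp0 p00]]|nK] := pselect (exists p, K p /\ p != 0); last first.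
  left=> p p' Kp Kp'; have K0 q : K q -> q = 0.
    by move=> Kq; apply: contra_notP nK => /eqP q0; exists q.
  by rewrite (K0 p Kp) (K0 p' Kp').
(* The gauge of the body, whose unit ball is [K]. *)
pose nrm (p : gaussInt * gaussInt) := Num.max (cabs (gaussC R p.1) / A)
  (cabs (alpha * gaussC R p.1 - gaussC R p.2) / eta).
have nrmP p c : nrm p <= c <-> cabs (gaussC R p.1) <= c * A /\
   cabs (alpha * gaussC R p.1 - gaussC R p.2) <= c * eta.
  rewrite /nrm ge_max !ler_pdivrMr//; split=> [/andP//|[-> ->]//].
have [p1 [Kp1 p10 p1min]] : exists p1, [/\ K p1, p1 != 0 &
    forall p, K p -> p != 0 -> nrm p1 <= nrm p].
  (* On [K] the second component is at most [|alpha| A + eta], so [K] lies in a finite box and a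
     shortest nonzero vector exists. *)
  pose n := (Num.truncn (A + cabs alpha * A + eta)).+1.
  pose box := [seq (x, y) | x <- gauss_box n, y <- gauss_box n].
  have Kbox p : K p -> p \in box.
    move=> [h1 h2]; apply/allpairsP; exists p => /=.
    have ha := cabs_ge0 alpha.
    have hn : A + cabs alpha * A + eta <= n%:R by apply/ltW/truncnS_gt.
    have ext (g : gaussInt) : cabs (gaussC R g) <= A + cabs alpha * A + eta -> g \in gauss_box n.
      move=> hg; apply: mem_gauss_box; rewrite -(ler_int R) intr_norm.
        by apply: le_trans (le_trans hg hn); exact: cabs_gauss_Re.
      by apply: le_trans (le_trans hg hn); exact: cabs_gauss_Im.
    split; last by case: p {h1 h2}.
      by apply: ext; have := mulr_ge0 ha (ltW A0); lra.
    apply: ext.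
    rewrite (_ : gaussC R p.2 = alpha * gaussC R p.1 - (alpha * gaussC R p.1 - gaussC R p.2)).
      apply: le_trans (cabsB _ _) _; rewrite cabsM.
      have := ler_wpM2l ha h1; lra.
    by rewrite opprB addrC subrK.
  pose s0 := [seq p <- box | `[<K p>] && (p != 0)].
  have p0s : p0 \in s0 by rewrite mem_filter p00 andbT Kbox// andbT; apply/asboolP.
  have [p1] := seq_argmin nrm p0s.
  rewrite mem_filter => /andP[/andP[/asboolP Kp1 p10] _] hmin.
  exists p1; split=> // p Kp pn0; apply: hmin.
  by rewrite mem_filter pn0 andbT Kbox// andbT; apply/asboolP.
have w10 : p1.1 != 0.
  apply/negP => /eqP w10; move: Kp1 => [_]; rewrite w10 rmorph0 mulr0 sub0r cabsN => h.
  have /cabs_gauss_lt1 r10 : cabs (gaussC R p1.2) < 1 by exact: le_lt_trans eta1.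
  by move: p10; case: (p1) w10 r10 => /= a b -> ->; rewrite eqxx.
have W10 : gaussC R p1.1 != 0 by rewrite gaussC_eq0.
pose lam := nrm p1.
have lam0 : 0 < lam by rewrite /lam /nrm lt_max divr_gt0// cabs_gt0.
have lam1 : lam <= 1 by apply/nrmP; rewrite !mul1r.
have [hw1 he1] := (nrmP p1 lam).1 (lexx _).
pose det (p : gaussInt * gaussInt) := p1.1 * p.2 - p.1 * p1.2.
have detP p : K p -> cabs (gaussC R (det p)) <= 2 * (A * eta * lam).
  move=> [h1 h2].
  rewrite (_ : gaussC R (det p) = gaussC R p.1 * (alpha * gaussC R p1.1 - gaussC R p1.2)
     - gaussC R p1.1 * (alpha * gaussC R p.1 - gaussC R p.2)); last first.
    by rewrite rmorphB !rmorphM; ring.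
  apply: le_trans (cabsB _ _) _; rewrite !cabsM.
  have := ler_pM (cabs_ge0 _) (cabs_ge0 _) h1 he1.
  have := ler_pM (cabs_ge0 _) (cabs_ge0 _) hw1 h2; lra.
(* A determinant is a Gaussian integer: if its bound is below 1 it vanishes, and every point is
   proportional to [p1]. *)
have [small|large] := ltP (2 * (A * eta * lam)) 1.
  left=> p p' Kp Kp'.
  have d0 q : K q -> p1.1 * q.2 = q.1 * p1.2.
    by move=> Kq; apply/eqP; rewrite -subr_eq0 -/(det q) (cabs_gauss_lt1 (le_lt_trans (detP q Kq) small)).
  apply: (gauss_mulIf w10).
  by rewrite -mulrA [_ * p1.1]mulrC (d0 _ Kp') -mulrA [p.2 * _]mulrC (d0 _ Kp); ring.
right=> s us hs.
(* The coordinate along [p1] is the quotient by that component of [p1] which attains its gauge. This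
   choice bounds it by [1 / lam] on all of [K]. *)
have [sc scB scD] : exists2 sc : gaussInt * gaussInt -> R[i],
    (forall p, K p -> cabs (sc p) <= lam^-1) &
    forall p p', p1.1 * (p.2 - p'.2) = (p.1 - p'.1) * p1.2 ->
      sc p - sc p' = (gaussC R (p.1 - p'.1)) / gaussC R p1.1.
  have [c|c] := leP (cabs (gaussC R p1.1) / A)
    (cabs (alpha * gaussC R p1.1 - gaussC R p1.2) / eta).
    have lamE : lam = cabs (alpha * gaussC R p1.1 - gaussC R p1.2) / eta.
      by rewrite /lam /nrm; apply/max_idPr.
    have E0 : alpha * gaussC R p1.1 - gaussC R p1.2 != 0.
      by rewrite -cabs_gt0; move: lam0; rewrite lamE pmulr_lgt0 ?invr_gt0.
    exists (fun p => (alpha * gaussC R p.1 - gaussC R p.2) /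
       (alpha * gaussC R p1.1 - gaussC R p1.2)).
      move=> p [_ h2]; rewrite cabsM cabsV lamE invf_div ler_pM2r// invr_gt0.
      by rewrite cabs_gt0.
    move=> p p' /(congr1 (gaussC R)); rewrite !rmorphM !rmorphB => e.
    have -> : gaussC R p.2 = gaussC R p'.2 + (gaussC R p.1 - gaussC R p'.1) * gaussC R p1.2 / gaussC R p1.1.
      by rewrite -e; field.
    by field; rewrite W10.
  have lamE : lam = cabs (gaussC R p1.1) / A by rewrite /lam /nrm; apply/max_idPl/ltW.
  exists (fun p => gaussC R p.1 / gaussC R p1.1).
    move=> p [h1 _]; rewrite cabsM cabsV lamE invf_div ler_pM2r// invr_gt0.
    by rewrite cabs_gt0.
  by move=> p p' _; rewrite rmorphB mulrBl.
(* The determinant selects a line parallel to [p1], and the floors a square of side 1/2 for the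
   coordinate. Two points with equal data would differ by [t p1] with [|t| < 1], a nonzero vector
   shorter than [p1]. *)
pose f p := (det p, GaussInt (Num.floor (2 * complex.Re (sc p)))
   (Num.floor (2 * complex.Im (sc p)))).
have finj : {in s &, injective f}.
  move=> p p' /hs Kp /hs Kp' fE; have dE : det p = det p' := congr1 fst fE.
  have hr := floor_eq_dist (congr1 (gauss_re \o snd) fE).
  have hi := floor_eq_dist (congr1 (gauss_im \o snd) fE).
  apply/eqP; apply: contraT => pp'.
  have e : p1.1 * (p.2 - p'.2) = (p.1 - p'.1) * p1.2.
    move: dE; rewrite /det => /eqP; rewrite subr_eq => /eqP dE.
    by rewrite mulrBr mulrBl dE; ring.
  have tE := scD p p' e; set t := sc p - sc p' in tE.
  have t1 : cabs t < 1.
    rewrite -(@ltr_pXn2r _ 2)// ?nnegrE ?cabs_ge0// expr1n cabs_sqr.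
    have {}hr : `|2 * complex.Re t| < 1.
      by move: hr; rewrite -mulrBr /t; case: (sc p) (sc p') => [? ?] [? ?].
    have {}hi : `|2 * complex.Im t| < 1.
      by move: hi; rewrite -mulrBr /t; case: (sc p) (sc p') => [? ?] [? ?].
    move: hr hi; rewrite !ltr_norml => /andP[h1 h2] /andP[h3 h4]; nra.
  pose d : gaussInt * gaussInt := (p.1 - p'.1, p.2 - p'.2).
  have d0 : d != 0.
    apply: contraNneq pp' => dz; rewrite [p]surjective_pairing [p']surjective_pairing.
    have /eqP := congr1 fst dz; rewrite subr_eq0 => /eqP ->.
    by have /eqP := congr1 snd dz; rewrite subr_eq0 => /eqP ->.
  have d1E : gaussC R d.1 = t * gaussC R p1.1 by rewrite tE divfK.
  have d2E : alpha * gaussC R d.1 - gaussC R d.2 = t * (alpha * gaussC R p1.1 - gaussC R p1.2).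
    have -> : gaussC R d.2 = t * gaussC R p1.2.
      have e' : p1.1 * d.2 = d.1 * p1.2 := e.
      apply: (mulfI W10); transitivity (gaussC R (d.1 * p1.2)).
        by rewrite -e' rmorphM.
      by rewrite gaussCM d1E; ring.
    by rewrite d1E; ring.
  have nd : nrm d <= cabs t * lam.
    apply/nrmP; rewrite d2E d1E !cabsM -!mulrA.
    by split; apply: ler_wpM2l => //; exact: cabs_ge0.
  have tl : cabs t * lam < lam by rewrite -[ltRHS]mul1r ltr_pM2r.
  have Kd : K d.
    have [] := (nrmP d 1).1; last by rewrite !mul1r.
    by apply: le_trans nd _; apply: le_trans (ltW tl) lam1.
  have := p1min d Kd d0; rewrite -/lam leNgt => /negP; case.
  exact: le_lt_trans nd tl.
rewrite (size_inj us finj).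
have L0 : 0 < lam^-1 by rewrite invr_gt0.
have L1 : 1 <= lam^-1 by rewrite invf_ge1.
apply: (@le_trans _ _ ((2 * (2 * (A * eta * lam)) + 1) ^+ 2 * (2 * (2 * lam^-1 + 1) + 1) ^+ 2)).
  apply: size_gauss_box2; rewrite ?undup_uniq//; [lra|lra|].
  move=> y; rewrite mem_undup => /mapP[p /hs Kp ->] /=.
  have fl (u : R) : `|u| <= lam^-1 -> `|(Num.floor (2 * u))%:~R| <= 2 * lam^-1 + 1.
    have := Num.Theory.floor_le (2 * u); have := floorD1_gt (2 * u); rewrite intrD.
    by rewrite !ler_norml => ? ? /andP[? ?]; apply/andP; split; lra.
  split.
  - exact: le_trans (cabs_gauss_Re _ _) (detP p Kp).
  - exact: le_trans (cabs_gauss_Im _ _) (detP p Kp).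
  - by apply: fl; exact: le_trans (cabs_Re _) (scB p Kp).
  - by apply: fl; exact: le_trans (cabs_Im _) (scB p Kp).
rewrite -exprMn lerXn2r ?nnegrE//.
- by apply: mulr_ge0; lra.
- by rewrite mulr_ge0// mulr_ge0// ltW.
rewrite -[in leRHS](mulfK (lt0r_neq0 lam0) (A * eta)).
move: (A * eta * lam) (lam^-1) large L1 => u v hu hv.
(* Since [u >= 1/2] and [v >= 1], the two side lengths [4 u + 1] and [4 v + 3] are at most [6 u] and
   [7 v]. *)
rewrite (_ : 42 * (u * v) = (6 * u) * (7 * v)); last by ring.
by apply: ler_pM; lra.
Qed.

(** All elements are roots of one polynomial [X^n - c] over the field [R[i]]. *)
Lemma size_roots_const (R : realType) (s : seq gaussInt) (n : nat) :
  (0 < n)%N -> uniq s ->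
  (forall z z', z \in s -> z' \in s -> z ^+ n = z' ^+ n) -> (size s <= n)%N.
Proof.
move=> n0; case: s => [//|z0 s] us hs.
pose c := gaussC R (z0 ^+ n).
rewrite -(size_map (gaussC R)) -ltnS -(size_XnsubC c n0).
apply: max_poly_roots; first by rewrite -size_poly_eq0 size_XnsubC.
  apply/allP => _ /mapP[z zs ->]; rewrite rootE !hornerE.
  by rewrite -rmorphXn (hs z z0) ?mem_head// subrr.
by rewrite map_inj_uniq//; exact: gaussC_inj.
Qed.

Lemma gauss_sum_diff_inj (a b c d : gaussInt) :
  a - b = c - d -> a + b = c + d -> a = c /\ b = d.
Proof.
case: a b c d => [a1 a2] [b1 b2] [c1 c2] [d1 d2] [e1 e2] [e3 e4].
by split; congr GaussInt; lia.
Qed.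

(** To be applied to the [n^2] pairs from a list of length [n]: at most [2 n] pairs have equal
    squares and [B^2] bounds the number of the others. *)
Lemma sqr_le_mul2D (R : realType) (n B : R) : 0 <= B -> n ^+ 2 <= 2 * n + B ^+ 2 -> n <= 2 + B.
Proof. by move=> B0 h; rewrite leNgt; apply/negP => hn; nra. Qed.

(* Pairs of squares: [z1^2 - z2^2] factors, so each difference arises from few pairs. *)
Lemma size_near_squares (R : realType) (eps : R) : 0 < eps ->
  exists2 C : R, 0 < C & forall (alpha : R[i]) (X eta : R) (r : gaussInt -> gaussInt)
    (s : seq gaussInt), 1 <= X -> 0 < eta -> eta <= 8^-1 -> uniq s ->
  (forall z, z \in s -> cabs (gaussC R z) ^+ 2 <= X /\
     cabs (alpha * gaussC R (z ^+ 2) - gaussC R (r z)) <= eta) ->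
  (forall z z', z \in s -> z' \in s -> z ^+ 2 * r z' = z' ^+ 2 * r z ->
     z ^+ 8 = z' ^+ 8) ->
  (size s)%:R <= C * X `^ eps * (1 + X * eta).
Proof.
move=> e0; have [C0 C00 hC0] := gauss_divisor_bound e0.
have C1 : 0 <= 1 + C0 by lra.
(* The 8 serves the case of proportional points, where all [z^8] agree. In the other case
   [168 = 42 * 4], as both sides of the body are doubled, and [1 + C0] dominates the square root of
   the divisor constant. *)
exists (8 + 168 * (1 + C0) * 2 `^ eps).
  by rewrite ltr_wpDr ?ltr0n// mulr_ge0 ?powR_ge0 ?mulr_ge0 ?ler0n.
move=> alpha X eta r s X1 eta0 eta8 us hs hdet.
have Xe1 : 1 <= X `^ eps by rewrite -(powRr0 X) ler_powR// ltW.
have P0 : 0 <= (2 : R) `^ eps by rewrite powR_ge0.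
have XH : 0 <= X * eta by rewrite mulr_ge0; lra.
have [A0 H0 H1] : [/\ 0 < 2 * X, 0 < 2 * eta & 2 * eta < 1] by split; lra.
(* Twice the body contains the points together with their differences. *)
have [dz|cnt] := @lattice_dichotomy R alpha (2 * X) (2 * eta) A0 H0 H1.
  have : (size s <= 8)%N.
    apply: (@size_roots_const R) => // z z' zs z's; apply: hdet => //.
    have Kz y : y \in s -> cabs (gaussC R (y ^+ 2)) <= 2 * X /\
        cabs (alpha * gaussC R (y ^+ 2) - gaussC R (r y)) <= 2 * eta.
      by move=> /hs[h1 h2]; rewrite rmorphXn cabsX -rmorphXn; split; lra.
    exact: (dz (z ^+ 2, r z) (z' ^+ 2, r z') (Kz z zs) (Kz z' z's)).
  rewrite -(ler_nat R) => /le_trans; apply.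
  have hA : 0 <= 168 * (1 + C0) * 2 `^ eps * X `^ eps.
    by rewrite !mulr_ge0 ?powR_ge0 ?ler0n.
  rewrite mulrDr mulr1 mulrDl.
  have := mulr_ge0 (addr_ge0 (_ : 0 <= 8 * X `^ eps) hA) XH.
  by move=> /(_ ltac:(lra)); lra.
set B1 := 168 * (X * eta) * ((1 + C0) * (2 * X) `^ eps).
have B10 : 0 <= B1 by rewrite /B1 !mulr_ge0 ?powR_ge0 ?ler0n ?(ltW eta0)//; lra.
suff hn : ((size s)%:R : R) <= 2 + B1.
  apply: le_trans hn _; rewrite /B1 powRM; [|lra..].
  have hA : 0 <= (1 + C0) * 2 `^ eps * X `^ eps by rewrite !mulr_ge0//; lra.
  have hB : 0 <= 8 * X `^ eps * (X * eta) by rewrite !mulr_ge0//; lra.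
  by lra.
apply: sqr_le_mul2D => //.
pose P := [seq (x, y) | x <- s, y <- s].
have uP : uniq P by apply: allpairs_uniq => // -[? ?] [? ?].
have memP x y : (x, y) \in P -> x \in s /\ y \in s by move=> /allpairsP[[a b] /= [? ? [-> ->]]].
have -> : ((size s)%:R ^+ 2 : R) = (size P)%:R by rewrite size_allpairs natrM.
(* A pair with equal squares is [(z, z)] or [(z, - z)]. The other pairs have a nonzero difference of
   squares, to which the divisor bound applies. *)
rewrite -(count_predC (fun u : gaussInt * gaussInt => u.1 ^+ 2 == u.2 ^+ 2)) natrD.
rewrite -!size_filter; apply: lerD.
  rewrite mulrC; apply: (size_fibers (f := fst)) => //.
    rewrite ler_nat; apply: uniq_leq_size; first exact: undup_uniq.
    by move=> x; rewrite mem_undup => /mapP[[a b]]; rewrite mem_filter => /andP[_ /memP[? ?]] ->.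
  move=> y; rewrite (size_inj (f := snd)) ?filter_uniq//; last first.
    by move=> [a b] [c d]; rewrite !mem_filter /= => /andP[/eqP -> _] /andP[/eqP -> _] ->.
  rewrite -[2]/(2%:R) ler_nat; apply: (@uniq_leq_size _ _ [:: y; - y]); first exact: undup_uniq.
  move=> x; rewrite mem_undup => /mapP[[a b]]; rewrite !mem_filter /=.
  move=> /and3P[/eqP <- /eqP ab _] ->; rewrite !inE.
  by have [->|->] := gauss_sqr_eq ab; rewrite ?opprK eqxx ?orbT.
pose f (u : gaussInt * gaussInt) := (u.1 ^+ 2 - u.2 ^+ 2, r u.1 - r u.2).
have -> : B1 ^+ 2 = (42 * (2 * X * (2 * eta))) ^+ 2 * ((1 + C0) * (2 * X) `^ eps) ^+ 2.
  by rewrite /B1; ring.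
apply: (size_fibers (f := f)); first by rewrite sqr_ge0.
  apply: cnt; first exact: undup_uniq.
  move=> y; rewrite mem_undup => /mapP[[a b]]; rewrite mem_filter.
  move=> /andP[_ /memP[/hs[ha1 ha2] /hs[hb1 hb2]]] ->.
  rewrite -[(f (a, b)).1]/(a ^+ 2 - b ^+ 2) -[(f (a, b)).2]/(r a - r b); split.
    rewrite rmorphB; apply: le_trans (cabsB _ _) _.
    by rewrite !rmorphXn !cabsX; lra.
  rewrite (_ : _ - _ = (alpha * gaussC R (a ^+ 2) - gaussC R (r a))
     - (alpha * gaussC R (b ^+ 2) - gaussC R (r b))); last first.
    by rewrite !rmorphB; ring.
  by apply: le_trans (cabsB _ _) _; lra.
move=> [w rho].
set t := [seq x <- _ | _ == _].
have ht u : u \in t -> [/\ u.1 \in s, u.2 \in s, w = u.1 ^+ 2 - u.2 ^+ 2 & w != 0].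
  rewrite !mem_filter => /and3P[/eqP [<- _] /= h].
  by case: u h => a b /= h /memP[? ?]; split=> //; rewrite subr_eq0.
case tE : t => [|u0 t']; first by rewrite sqr_ge0.
have [u01 u02 wE w0] := ht u0 ltac:(by rewrite tE mem_head).
(* For a given [w != 0], the divisor [z - z'] determines the pair, because [z + z'] is the
   complementary divisor. *)
rewrite -tE (size_inj (f := fun u => u.1 - u.2)) ?filter_uniq//; last first.
  move=> [a b] [c d] /ht[/= _ _ e1 _] /ht[/= _ _ e2 _] e3.
  have d0 : a - b != 0 by apply: contraNneq w0 => d0; rewrite e1 subr_sqr d0 mul0r.
  have e4 : a + b = c + d.
    by apply: (gauss_mulIf d0); rewrite {2}e3 ![_ * (_ - _)]mulrC -!subr_sqr -e1.
  by have [-> ->] := gauss_sum_diff_inj e3 e4.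
have -> : ((1 + C0) * (2 * X) `^ eps) ^+ 2 = (1 + C0) ^+ 2 * ((2 * X) ^+ 2) `^ eps.
  by rewrite exprMn; congr (_ * _); rewrite [in RHS]expr2 [RHS]powRM ?(ltW A0)// expr2.
apply: (@le_trans _ _ (C0 * (gauss_norm w)%:~R `^ eps)).
  apply: hC0 => //; first exact: undup_uniq.
  move=> d; rewrite mem_undup => /mapP[u /ht[_ _ e _] ->]; exists (u.1 + u.2).
  by rewrite e subr_sqr mulrC.
apply: ler_pM; rewrite ?powR_ge0//; [lra|nra|].
apply: ge0_ler_powR; rewrite ?nnegrE ?sqr_ge0 ?ler0z ?gauss_norm_ge0//; first exact: ltW.
rewrite -cabs_gaussC lerXn2r ?nnegrE ?cabs_ge0//; first lra.
rewrite wE rmorphB; apply: le_trans (cabsB _ _) _.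
have [h1 _] := hs _ u01; have [h2 _] := hs _ u02.
by rewrite !rmorphXn !cabsX; lra.
Qed.

(** * Moduli with a fixed square part *)

Lemma intr_normr_ge1 (R : realType) (k : int) : k != 0 -> 1 <= `|k%:~R| :> R.
Proof. by move=> k0; rewrite -intr_norm -[1]/(1%:~R) ler_int; lia. Qed.

Lemma denq_dvd (a : int) (m : nat) : (0 < m)%N ->
  let q := a%:~R / m%:R : rat in
  (`|denq q| %| m)%N /\ a * denq q = numq q * m%:Z.
Proof.
move=> m0 q.
have e : a * denq q = numq q * m%:Z.
  have m0' : (m%:Z%:~R : rat) != 0 by rewrite intr_eq0; lia.
  have d0 : ((denq q)%:~R : rat) != 0 by rewrite intr_eq0 denq_neq0.
  apply/eqP; rewrite -(eqr_int rat) !intrM; apply/eqP.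
  have : q = (numq q)%:~R / (denq q)%:~R by rewrite divq_num_den.
  rewrite {1}/q -[m%:R]/(m%:Z%:~R) => /eqP; rewrite eqr_div// => /eqP //.
split=> //.
have h : (`|denq q| %| `|numq q| * m)%N.
  by apply/dvdnP; exists `|a|%N; rewrite -[m in LHS]/`|m%:Z|%N -!abszM -e.
by move: h; rewrite Gauss_dvdr// coprime_sym coprime_num_den.
Qed.

Section FareyPairs.
Variables (R : realType) (beta : R[i]) (M eta : R) (r : nat -> gaussInt) (s : seq nat).
Hypotheses (M1 : 1 <= M) (eta0 : 0 < eta) (eta1 : eta <= 1) (us : uniq s).
Hypothesis sM : forall m, m \in s -> M <= m%:R < 2 * M.
Hypothesis sr : forall m, m \in s -> cabs (beta * m%:R - gaussC R (r m)) <= eta.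
Hypothesis sI : forall m m', m \in s -> m' \in s ->
  r m * m'%:R = r m' * m%:R -> m = m'.

Let x m : rat := (gauss_re (r m))%:~R / m%:R.

Lemma farey_den_gt0 m : m \in s -> (0 < m)%N.
Proof. by move=> /sM /andP[h _]; rewrite -(ltr0n R); exact: lt_le_trans (lt_le_trans ltr01 M1) h. Qed.

Lemma farey_dist (z w : R[i]) m : m \in s -> w = m%:R -> cabs (z * w - gaussC R (r m)) <= eta ->
  `|complex.Re z - (gauss_re (r m))%:~R / m%:R| <= eta / M /\
  `|complex.Im z - (gauss_im (r m))%:~R / m%:R| <= eta / M.
Proof.
move=> ms wE h; have m0 : 0 < m%:R :> R by rewrite ltr0n farey_den_gt0.
have M0 : 0 < M := lt_le_trans ltr01 M1.
have /andP[Mm _] := sM ms.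
have aux (u v : R) : `|u * m%:R - v| <= eta -> `|u - v / m%:R| <= eta / M.
  move=> huv; have -> : u - v / m%:R = (u * m%:R - v) / m%:R by field; rewrite gt_eqF.
  rewrite normrM normfV (gtr0_norm m0); apply: ler_pM => //.
  by rewrite lef_pV2.
have wC : w = (m%:R%:C)%C by rewrite wE (rmorph_nat (real_complex R)).
move: h; rewrite wC; case: z => u v h; split; apply: aux.
  by apply: le_trans (le_trans (cabs_Re _) h); rewrite /= mulr0 subr0.
by apply: le_trans (le_trans (cabs_Im _) h); rewrite /= mulr0 add0r.
Qed.

(** Distinct real parts with reduced denominators below [2 D] are [1 / (2 D)^2] apart. Once the real
    part is fixed, its denominator [b] divides every [m], so the numerator of a difference of
    imaginary parts is a multiple of [b], and these parts are [D / (2 M)^2] apart. Large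
    denominators thus weaken the first spacing but improve the second. *)
Lemma size_farey_pairs_block (D : R) : 1 <= D ->
  forall t, uniq t -> {subset t <= s} ->
  (forall m, m \in t -> D <= (`|denq (x m)|%N)%:R < 2 * D) ->
  (size t)%:R <= 1 + 168 * (M * eta).
Proof.
move=> D1 t ut ts tD; have D0 : 0 < D by lra.
have M0 : 0 < M := lt_le_trans ltr01 M1.
case: t ut ts tD => [|m0 t0] ut ts tD.
  by rewrite addr_ge0 ?mulr_ge0 ?ler0n ?ltW.
set t := m0 :: t0 in ut ts tD *.
have D2M : D <= 2 * M.
  have m0t : m0 \in t by exact: mem_head.
  have /andP[h _] := tD _ m0t; have /andP[_ h2] := sM (ts _ m0t).
  apply: le_trans h _; apply: le_trans (ltW h2); rewrite ler_nat.
  by apply: dvdn_leq; [exact/farey_den_gt0/ts|case: (denq_dvd (gauss_re (r m0)) (farey_den_gt0 (ts _ m0t)))].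
have dq (q : rat) : 0 < (denq q)%:~R :> R by rewrite ltr0z denq_gt0.
have dqE (q : rat) : (`|denq q|%N)%:R = (denq q)%:~R :> R.
  by rewrite -[X in X%:R = _]/`|denq q|%N pmulrn gez0_abs// ltW// denq_gt0.
have xE m : m \in t -> (gauss_re (r m))%:~R / m%:R = (numq (x m))%:~R / (denq (x m))%:~R :> R.
  move=> mt; have m_gt0 := farey_den_gt0 (ts _ mt).
  have [_ e] := denq_dvd (gauss_re (r m)) m_gt0.
  apply/eqP; rewrite eqr_div ?intr_eq0 ?denq_neq0// ?pnatr_eq0 -?lt0n//.
  by rewrite -[m%:R]/(m%:Z%:~R) -!intrM eqr_int; apply/eqP.
(* Both coordinates of the fractions lie in intervals of length [2 eta / M]; each factor is that
   length over a spacing, plus 1. *)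
apply: (@le_trans _ _ ((2 * (eta / M) / (2 * D) ^- 2 + 1) * (2 * (eta / M) / (D / (2 * M) ^+ 2) + 1))).
  have I0 : 0 <= 2 * (eta / M) by rewrite mulr_ge0 ?divr_ge0 ?ltW.
  apply: (size_fibers (f := x)).
    by rewrite addr_ge0// divr_ge0// divr_ge0 ?sqr_ge0// ltW.
    apply: (size_spaced (f := fun q : rat => (numq q)%:~R / (denq q)%:~R)
      (lo := complex.Re beta - eta / M)); rewrite ?undup_uniq//.
      by rewrite invr_gt0 exprn_gt0//; lra.
      move=> q q'; rewrite !mem_undup => /mapP[m mt ->] /mapP[m' m't ->].
      have /andP[_ h] := tD _ mt; have /andP[_ h'] := tD _ m't.
      rewrite dqE in h; rewrite dqE in h'.
      set q1 := x m; set q2 := x m' => q12.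
      have -> : (numq q1)%:~R / (denq q1)%:~R - (numq q2)%:~R / (denq q2)%:~R =
        (numq q1 * denq q2 - numq q2 * denq q1)%:~R / ((denq q1)%:~R * (denq q2)%:~R) :> R.
        by rewrite -mulNr addf_div ?lt0r_neq0// intrB !intrM mulNr.
      rewrite normrM normfV (gtr0_norm (mulr_gt0 (dq _) (dq _))).
      rewrite -[leLHS]mul1r; apply: ler_pM => //.
        by rewrite invr_ge0 sqr_ge0.
        apply: intr_normr_ge1; rewrite subr_eq0; apply: contraNneq q12 => e.
        rewrite -[q1]divq_num_den -[q2]divq_num_den eqr_div ?intr_eq0 ?denq_neq0//.
        by rewrite -!intrM e.
      rewrite lef_pV2 ?posrE ?exprn_gt0 ?mulr_gt0//.
      by rewrite expr2; apply: ler_pM; rewrite ?(ltW (dq _)) ?ltW.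
    move=> q; rewrite mem_undup => /mapP[m mt ->].
    rewrite -xE//; have [h _] := farey_dist (ts _ mt) erefl (sr (ts _ mt)).
    by move: h; rewrite ler_norml => /andP[? ?]; apply/andP; split; lra.
  move=> q; apply: (size_spaced (f := fun m => (gauss_im (r m))%:~R / m%:R)
      (lo := complex.Im beta - eta / M)); rewrite ?filter_uniq//.
    by rewrite divr_gt0// exprn_gt0//; lra.
    move=> m m'; rewrite !mem_filter => /andP[/eqP xm mt] /andP[/eqP xm' m't] mm'.
    have m_gt0 := farey_den_gt0 (ts _ mt); have m'_gt0 := farey_den_gt0 (ts _ m't).
    have M0' : 0 < m%:R :> R by rewrite ltr0n.
    have M0'' : 0 < m'%:R :> R by rewrite ltr0n.
    have [/dvdnP[g gE] e1] := denq_dvd (gauss_re (r m)) m_gt0.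
    have [/dvdnP[g' gE'] e2] := denq_dvd (gauss_re (r m')) m'_gt0.
    rewrite -/(x m) xm in gE e1; rewrite -/(x m') xm' in gE' e2.
    set b := `|denq q|%N in gE gE'.
    have re_eq : gauss_re (r m) * m'%:Z = gauss_re (r m') * m%:Z.
      apply: (mulIf (denq_neq0 q)).
      by rewrite mulrAC e1 [in RHS]mulrAC e2; ring.
    pose k := gauss_im (r m) * g'%:Z - gauss_im (r m') * g%:Z.
    have kE : gauss_im (r m) * m'%:Z - gauss_im (r m') * m%:Z = k * b%:Z.
      by rewrite /k gE gE' !PoszM; ring.
    have k0 : k != 0.
      apply: contraNneq mm' => k0; apply/eqP/sI; [exact: ts|exact: ts|].
      move: kE; rewrite k0 mul0r => /eqP; rewrite subr_eq0 => /eqP im_eq.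
      rewrite !gauss_natE; move: re_eq im_eq; case: (r m) (r m') => [a1 a2] [b1 b2] /= re_eq im_eq.
      by congr GaussInt; rewrite /= !mulr0 ?subr0 ?add0r.
    have -> : (gauss_im (r m))%:~R / m%:R - (gauss_im (r m'))%:~R / m'%:R =
       (k * b%:Z)%:~R / (m%:R * m'%:R) :> R.
      by rewrite -kE intrB !intrM -mulNr addf_div ?lt0r_neq0// mulNr.
    rewrite normrM normfV (gtr0_norm (mulr_gt0 M0' M0'')).
    have /andP[hb _] := tD _ mt; rewrite xm -/b in hb.
    have /andP[_ hm] := sM (ts _ mt); have /andP[_ hm'] := sM (ts _ m't).
    apply: ler_pM; rewrite ?(ltW D0) ?invr_ge0 ?sqr_ge0//.
      rewrite intrM normrM; apply: (le_trans hb).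
      by rewrite -[leLHS]mul1r; apply: ler_pM; rewrite ?ler0n ?intr_normr_ge1 ?ler_norm.
    rewrite lef_pV2 ?posrE ?exprn_gt0 ?mulr_gt0//.
    by rewrite expr2; apply: ler_pM; rewrite ?ler0n// ltW.
  move=> m; rewrite mem_filter => /andP[_ mt].
  have [_ h] := farey_dist (ts _ mt) erefl (sr (ts _ mt)).
  by move: h; rewrite ler_norml => /andP[? ?]; apply/andP; split; lra.
have -> : 2 * (eta / M) / (2 * D) ^- 2 + 1 = 8 * eta * (D * (D / M)) + 1.
  by field; rewrite !gt_eqF.
have -> : 2 * (eta / M) / (D / (2 * M) ^+ 2) + 1 = 8 * eta * (M / D) + 1.
  by field; rewrite !gt_eqF.
have DM : D / M <= 2 by rewrite ler_pdivrMr.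
have DM0 : 0 <= D / M by rewrite divr_ge0 ?ltW.
have MD : M / D <= M by rewrite ler_pdivrMr// ler_peMr// ltW.
have MD0 : 0 <= M / D by rewrite divr_ge0 ?ltW.
have MDDM : (D / M) * (M / D) = 1 by field; rewrite !gt_eqF.
have -> : (8 * eta * (D * (D / M)) + 1) * (8 * eta * (M / D) + 1) =
  64 * (eta * eta) * D * ((D / M) * (M / D)) + 8 * (eta * (D * (D / M))) + 8 * (eta * (M / D)) + 1.
  by ring.
rewrite MDDM mulr1.
(* In units of [M eta], the three terms contribute [64 * 2], [8 * 4] and [8], which add up to
   168. *)
have h1 : D * (D / M) <= 4 * M.
  apply: le_trans (ler_pM (ltW D0) DM0 D2M DM) _; lra.
have h2 : eta * (D * (D / M)) <= eta * (4 * M) by rewrite ler_pM2l.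
have h3 : eta * (M / D) <= eta * M by rewrite ler_pM2l.
have h4 : eta * eta * D <= eta * (2 * M).
  by rewrite -mulrA ler_pM2l//; apply: le_trans D2M; rewrite ler_piMl// ltW.
lra.
Qed.

(** The reduced denominator divides [m < 2^K], so it falls into one of [K] dyadic ranges; [K] will
    be logarithmic in [Q]. *)
Lemma size_farey_pairs (K : nat) : (forall m, m \in s -> (m < 2 ^ K)%N) ->
  (size s)%:R <= K%:R * (1 + 168 * (M * eta)).
Proof.
move=> sK.
have bnd m : m \in s -> (0 < `|denq (x m)| <= m)%N.
  move=> ms; rewrite absz_gt0 denq_neq0 /=; apply: dvdn_leq; first exact: farey_den_gt0.
  by case: (denq_dvd (gauss_re (r m)) (farey_den_gt0 ms)).
apply: (size_fibers (f := fun m => trunc_log 2 `|denq (x m)|)).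
- by rewrite addr_ge0 ?mulr_ge0 ?ler0n ?(ltW eta0)// (le_trans ler01 M1).
- rewrite ler_nat -[leqRHS](size_iota 0 K); apply: uniq_leq_size; first exact: undup_uniq.
  move=> j; rewrite mem_undup => /mapP[m ms ->]; rewrite mem_iota add0n /=.
  have /andP[h1 h2] := bnd m ms.
  rewrite -(ltn_exp2l _ _ (isT : 1 < 2)%N); apply: leq_ltn_trans (sK m ms).
  exact: leq_trans (trunc_logP _ _) h2.
move=> j; apply: (@size_farey_pairs_block (2 ^+ j)); rewrite ?filter_uniq//.
- by rewrite exprn_ege1// ler1n.
- by move=> m; rewrite mem_filter => /andP[].
move=> m; rewrite mem_filter => /andP[/eqP <- ms].
have /andP[h1 h2] := bnd m ms.
rewrite -exprS -!natrX ler_nat ltr_nat trunc_logP//=.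
exact: trunc_log_ltn.
Qed.

End FareyPairs.

(** Coprimality of [q] and [r] turns [q | q' r] into [q | q'], and symmetrically: equal reduced
    fractions have associated denominators. *)
Lemma gauss_associated (q q' r r' : gaussInt) : q' != 0 ->
  gauss_coprime r q -> gauss_coprime r' q' -> q * r' = q' * r ->
  exists2 u, gauss_unit u & q' = u * q.
Proof.
move=> q'0 cq cq' e.
have [u uE] : gauss_dvd q q'.
  apply: (@gauss_coprime_dvd_mul q r); first exact: gauss_coprime_sym.
  by exists r'; rewrite mulrC -e mulrC.
have [v vE] : gauss_dvd q' q.
  apply: (@gauss_coprime_dvd_mul q' r'); first exact: gauss_coprime_sym.
  by exists r; rewrite mulrC e mulrC.
exists u => //; exists v; apply: (gauss_mulIf q'0).
by rewrite mul1r [v * u]mulrC -mulrA -vE -uE.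
Qed.

(** * Moduli near a point *)

Lemma gauss_double_inj (a b : gaussInt) : 2 * a = 2 * b -> a = b.
Proof. by rewrite ![2 * _]mulrC; apply: gauss_mulIf. Qed.

Section NearFractions.
Variables (R : realType) (beta : R[i]) (Q eta : R) (s : seq gaussInt).
Variables (r z : gaussInt -> gaussInt) (m : gaussInt -> nat).
Hypotheses (Q1 : 1 <= Q) (eta0 : 0 < eta) (eta8 : eta <= 8^-1).
Hypothesis s0 : forall q, q \in s -> q != 0.
Hypothesis sP : forall q, q \in s -> 2 * q = (m q)%:R * z q ^+ 2.
Hypothesis sC : forall q, q \in s -> gauss_coprime (r q) q.
Hypothesis sE : forall q, q \in s ->
  cabs (beta * gaussC R q - gaussC R (r q)) <= eta.
Hypothesis sQ : forall q, q \in s ->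
  (m q)%:R * cabs (gaussC R (z q)) ^+ 2 <= 2 * Q.

Lemma near_m_gt0 q : q \in s -> (0 < m q)%N.
Proof.
move=> qs; rewrite lt0n; apply: contraNneq (s0 qs) => m0.
by apply/eqP/gauss_double_inj; rewrite mulr0 sP// m0 mul0r.
Qed.

Lemma near_z_ge1 q : q \in s -> 1 <= cabs (gaussC R (z q)).
Proof.
move=> qs; apply: cabs_gauss_ge1; apply: contraNneq (s0 qs) => z0.
by apply/eqP/gauss_double_inj; rewrite mulr0 sP// z0 expr0n mulr0.
Qed.

Lemma near_associated q q' : q \in s -> q' \in s -> 2 * q * r q' = 2 * q' * r q ->
  exists2 u, gauss_unit u & q' = u * q.
Proof.
move=> qs q's e; apply: (gauss_associated (s0 q's) (sC qs) (sC q's)).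
by apply: gauss_double_inj; rewrite !mulrA.
Qed.

Lemma near_gaussC q : q \in s ->
  gaussC R q = (m q)%:R / 2 * gaussC R (z q) ^+ 2.
Proof.
move=> qs; have e := congr1 (gaussC R) (sP qs).
have e' : 2 * gaussC R q = (m q)%:R * gaussC R (z q) ^+ 2.
  by move: e; rewrite (gaussCM _ 2) (gaussCM _ _%:R) gaussCX !(rmorph_nat (gaussC R)).
by rewrite mulrAC -e' mulrAC divff ?mul1r// pnatr_eq0.
Qed.

(** For [m = m0] one has [beta q = (beta m0 / 2) z^2], so the count of near squares applies with
    [X = 2 Q / m0]. That count enters as a hypothesis in order to have one constant [C] for all
    multipliers. *)
Lemma size_near_fixed_multiplier (C eps : R) (m0 : nat) (u : seq gaussInt) : 0 <= C -> 0 < eps ->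
  (forall (alpha : R[i]) (X eta : R) (r : gaussInt -> gaussInt)
    (s : seq gaussInt), 1 <= X -> 0 < eta -> eta <= 8^-1 -> uniq s ->
  (forall z, z \in s -> cabs (gaussC R z) ^+ 2 <= X /\
     cabs (alpha * gaussC R (z ^+ 2) - gaussC R (r z)) <= eta) ->
  (forall z z', z \in s -> z' \in s -> z ^+ 2 * r z' = z' ^+ 2 * r z ->
     z ^+ 8 = z' ^+ 8) ->
  (size s)%:R <= C * X `^ eps * (1 + X * eta)) ->
  uniq u -> {subset u <= s} -> (forall q, q \in u -> m q = m0) ->
  (size u)%:R <= C * (2 * Q) `^ eps * (1 + 2 * Q / m0%:R * eta).
Proof.
move=> C0 eps0 hC uu us um.
have Q0 : 0 <= 2 * Q by rewrite mulr_ge0// (le_trans ler01 Q1).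
case: u uu us um => [|q0 u0] uu us um.
  have Qm : 0 <= 2 * Q / m0%:R by rewrite divr_ge0// ler0n.
  apply: mulr_ge0; first by rewrite mulr_ge0 ?powR_ge0.
  by rewrite addr_ge0// mulr_ge0 ?(ltW eta0).
set u := q0 :: u0 in uu us um *.
have q0u : q0 \in u by exact: mem_head.
have m0_gt0 : 0 < m0%:R :> R by rewrite -(um _ q0u) ltr0n near_m_gt0// us.
have m1 : 1 <= m0%:R :> R by rewrite ler1n -(ltr0n R).
have mQ : m0%:R <= 2 * Q.
  have := sQ (us _ q0u); rewrite (um _ q0u); apply: le_trans.
  by rewrite ler_peMr ?ler0n// exprn_ege1// near_z_ge1// us.
have zi q q' : q \in u -> q' \in u -> z q = z q' -> q = q'.
  by move=> qu q'u e; apply: gauss_double_inj; rewrite !sP ?us// e !um.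
pose qof y := xget 0 [set q | q \in u /\ z q = y].
have qofE q : q \in u -> qof (z q) = q.
  move=> qu; have [] := @xgetPex _ 0 [set q' | q' \in u /\ z q' = z q]; first by exists q.
  by move=> h e; apply: zi.
have -> : size u = size (undup (map z u)) by apply: size_inj => // q q' qu q'u; exact: zi.
apply: (@le_trans _ _ (C * (2 * Q / m0%:R) `^ eps * (1 + 2 * Q / m0%:R * eta))).
  apply: (hC (beta * m0%:R / 2) _ _ (fun y => r (qof y))) => //.
  - by rewrite ler_pdivlMr// mul1r.
  - exact: undup_uniq.
  - move=> y; rewrite mem_undup => /mapP[q qu ->]; rewrite qofE//; split.
      by rewrite ler_pdivlMr// mulrC -(um _ qu) sQ// us.
    have := sE (us _ qu); rewrite near_gaussC ?us// um// gaussCX.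
    by rewrite (_ : beta * _ = beta * m0%:R / 2 * gaussC R (z q) ^+ 2)//; ring.
  move=> y y'; rewrite !mem_undup => /mapP[q qu ->] /mapP[q' q'u ->].
  rewrite !qofE// => e.
  have [|v /gauss_unit_expr4 v4 qE] := @near_associated q q' (us _ qu) (us _ q'u).
    by rewrite !sP ?us// !um// -mulrA e mulrA.
  (* The unit [v] satisfies [v^4 = 1], hence the exponent 8 in the condition on proportional
     points. *)
  have e2 : z q' ^+ 2 = v * z q ^+ 2.
    have mz : (m0%:R : gaussInt) != 0.
      by rewrite gauss_natE -gauss_norm_eq0 /gauss_norm /= expr0n addr0 sqrf_eq0 -lt0n -(ltr0n R).
    apply: (gauss_mulIf mz); transitivity (2 * q').
      by rewrite (sP (us _ q'u)) (um _ q'u) mulrC.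
    transitivity (v * (2 * q)); first by rewrite qE; ring.
    by rewrite (sP (us _ qu)) (um _ qu); ring.
  have -> : z q' ^+ 8 = (z q' ^+ 2) ^+ 4 by rewrite -exprM.
  by rewrite e2 exprMn v4 mul1r -exprM.
have Xm : 2 * Q / m0%:R <= 2 * Q by rewrite ler_pdivrMr// ler_peMr.
have X0 : 0 <= 2 * Q / m0%:R by rewrite divr_ge0// ltW.
apply: ler_wpM2r; first by rewrite addr_ge0// mulr_ge0// ltW.
by apply: ler_wpM2l => //; apply: ge0_ler_powR; rewrite ?nnegrE// ltW.
Qed.

(** For [z = z0] one has [beta q = (beta z0^2 / 2) m], so the fractions [r / m] cluster at one
    point. They are distinct: equal ones have associated [q], and comparing norms gives equal
    [m]. *)
Lemma size_near_fixed_square (z0 : gaussInt) (M : R) (K : nat) (u : seq gaussInt) :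
  1 <= M -> uniq u -> {subset u <= s} -> (forall q, q \in u -> z q = z0) ->
  (forall q, q \in u -> M <= (m q)%:R < 2 * M) ->
  (forall q, q \in u -> (m q < 2 ^ K)%N) ->
  (size u)%:R <= K%:R * (1 + 168 * (M * eta)).
Proof.
move=> M1 uu us uz uM uK.
have mi q q' : q \in u -> q' \in u -> m q = m q' -> q = q'.
  by move=> qu q'u e; apply: gauss_double_inj; rewrite !sP ?us// e !uz.
pose qof y := xget 0 [set q | q \in u /\ m q = y].
have qofE q : q \in u -> qof (m q) = q.
  move=> qu; have [] := @xgetPex _ 0 [set q' | q' \in u /\ m q' = m q]; first by exists q.
  by move=> h e; apply: mi.
have -> : size u = size (undup (map m u)) by apply: size_inj => // q q' qu q'u; exact: mi.
apply: (@size_farey_pairs R (beta * gaussC R z0 ^+ 2 / 2) M eta (fun y => r (qof y))) => //.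
- by apply: le_trans eta8 _; rewrite invf_le1 ?ler1n ?ltr0n.
- exact: undup_uniq.
- by move=> y; rewrite mem_undup => /mapP[q qu ->]; exact: uM.
- move=> y; rewrite mem_undup => /mapP[q qu ->]; rewrite qofE//.
  have := sE (us _ qu); rewrite near_gaussC ?us// uz//.
  by rewrite (_ : beta * _ = beta * gaussC R z0 ^+ 2 / 2 * (m q)%:R)//; ring.
- move=> y y'; rewrite !mem_undup => /mapP[q qu ->] /mapP[q' q'u ->].
  rewrite !qofE// => e.
  have [|v /gauss_unitP v1 qE] := @near_associated q q' (us _ qu) (us _ q'u).
    rewrite !sP ?us// !uz//.
    transitivity (z0 ^+ 2 * (r q' * (m q)%:R)); first by ring.
    by rewrite -e; ring.
  have : gauss_norm (2 * q') = gauss_norm (2 * q).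
    by rewrite qE (_ : 2 * (v * q) = v * (2 * q)); [rewrite gauss_normM v1 mul1r|ring].
  have z00 : z0 != 0.
    apply: contraTneq (near_z_ge1 (us _ qu)) => z00.
    by rewrite uz// z00 rmorph0 cabs0 ler10.
  have nz : gauss_norm z0 * gauss_norm z0 != 0 by rewrite mulf_neq0 ?gauss_norm_eq0.
  rewrite !sP ?us// !uz// !gauss_normM => /(mulIf nz).
  by rewrite !gauss_norm_nat => /eqP; rewrite eqrXn2// => /eqP [].
- by move=> y; rewrite mem_undup => /mapP[q qu ->]; exact: uK.
Qed.

Lemma size_near_block_multiplier (B : R) (j : nat) (t : seq gaussInt) :
  uniq t -> 0 <= B -> (forall q, q \in t -> (2 ^ j <= m q < 2 ^ j.+1)%N) ->
  (forall m0 : nat, (2 ^ j <= m0)%N -> forall u, uniq u -> {subset u <= t} ->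
    (forall q, q \in u -> m q = m0) -> (size u)%:R <= B) ->
  (size t)%:R <= 2 ^+ j * B.
Proof.
move=> ut B0 tm hB; apply: (size_fibers (f := m)) => //.
  rewrite -natrX ler_nat -[leqRHS](size_iota (2 ^ j) (2 ^ j)).
  apply: uniq_leq_size; first exact: undup_uniq.
  move=> y; rewrite mem_undup => /mapP[q /tm h ->].
  by rewrite mem_iota addnn -mul2n -expnS.
move=> y; case E : [seq q <- t | m q == y] => [|q0 u0] //.
rewrite -E; apply: (hB y); rewrite ?filter_uniq//.
- have : q0 \in [seq q <- t | m q == y] by rewrite E mem_head.
  by rewrite mem_filter => /andP[/eqP <- /tm /andP[]].
- by move=> q; rewrite mem_filter => /andP[].
- by move=> q; rewrite mem_filter => /andP[/eqP].
Qed.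

Lemma size_near_block_square (K j : nat) (t : seq gaussInt) :
  uniq t -> {subset t <= s} -> (forall q, q \in t -> (2 ^ j <= m q < 2 ^ j.+1)%N) ->
  (j < K)%N ->
  (size t)%:R <= 18 * Q / 2 ^+ j * (K%:R * (1 + 168 * (2 ^+ j * eta))).
Proof.
move=> ut ts tm jK.
have M0 : 0 < 2 ^+ j :> R by rewrite exprn_gt0.
have B0 : 0 <= K%:R * (1 + 168 * (2 ^+ j * eta)).
  by rewrite mulr_ge0 ?ler0n// addr_ge0// mulr_ge0 ?ler0n// mulr_ge0 ?(ltW M0) ?(ltW eta0).
have Q0 : 0 <= Q := le_trans ler01 Q1.
case: t ut ts tm => [|q0 t0] ut ts tm.
  by rewrite mulr_ge0// divr_ge0 ?(ltW M0)// mulr_ge0// ler0n.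
set t := q0 :: t0 in ut ts tm *.
apply: (size_fibers (f := z)) => //.
  pose B := Num.sqrt (2 * Q / 2 ^+ j).
  have BE : B ^+ 2 = 2 * Q / 2 ^+ j.
    by rewrite sqr_sqrtr// divr_ge0 ?(ltW M0)// mulr_ge0.
  have zB q : q \in t -> cabs (gaussC R (z q)) <= B.
    move=> qt; rewrite -(@ler_pXn2r _ 2)// ?nnegrE ?cabs_ge0 ?sqrtr_ge0// BE.
    rewrite ler_pdivlMr// mulrC; apply: le_trans (sQ (ts _ qt)).
    by apply: ler_wpM2r; rewrite ?sqr_ge0// -natrX ler_nat; case/andP: (tm _ qt).
  have B1 : 1 <= B.
    by apply: le_trans (zB q0 _); rewrite ?mem_head// near_z_ge1// ts// mem_head.
  apply: (@le_trans _ _ ((2 * B + 1) ^+ 2)).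
    apply: size_gauss_box; rewrite ?undup_uniq// ?sqrtr_ge0//.
    move=> y; rewrite mem_undup => /mapP[q qt ->]; split; apply: le_trans (zB _ qt).
      exact: cabs_gauss_Re.
    exact: cabs_gauss_Im.
  (* As [B >= 1], the box has at most [(2 B + 1)^2 <= 9 B^2] elements. *)
  rewrite (_ : 18 * Q / 2 ^+ j = 9 * (2 * Q / 2 ^+ j)); last by ring.
  by rewrite -BE; nra.
move=> y; apply: (@size_near_fixed_square y); rewrite ?filter_uniq//.
- by rewrite exprn_ege1// ler1n.
- by move=> q; rewrite mem_filter => /andP[_ /ts].
- by move=> q; rewrite mem_filter => /andP[/eqP].
- by move=> q; rewrite mem_filter => /andP[_ /tm]; rewrite -exprS -!natrX ler_nat ltr_nat.
- move=> q; rewrite mem_filter => /andP[_ /tm /andP[_ h]].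
  by apply: leq_trans h _; rewrite leq_exp2l.
Qed.

End NearFractions.

Lemma size_near_fractions (R : realType) (eps : R) : 0 < eps ->
  exists2 C : R, 0 < C & forall (beta : R[i]) (Q eta : R) (r : gaussInt -> gaussInt)
    (s : seq gaussInt), 1 <= Q -> 0 < eta -> eta <= 8^-1 -> uniq s ->
    (forall q, q \in s -> [/\ q != 0, (gauss_norm q)%:~R <= Q ^+ 2,
       exists k : int, gauss_norm q = k ^+ 2, gauss_coprime (r q) q &
       cabs (beta * gaussC R q - gaussC R (r q)) <= eta]) ->
    (size s)%:R <= C * Q `^ eps * (Num.sqrt Q + Q * eta).
Proof.
(* Half of [eps] pays for the number [K] of dyadic blocks, the other half for the loss inside a
   block, which comes from divisors or from the [K] ranges of denominators. *)
move=> e0; pose e := eps / 2; have e_gt0 : 0 < e by rewrite divr_gt0.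
have [C1 C10 hC1] := size_near_squares e_gt0.
have c1 : 1 < (2 : R) `^ e.
  have := @gt0_ltr_powR R e e_gt0 1 2; rewrite powR1.
  by apply; rewrite ?nnegrE// ltr1n.
have [K0 K00 hK0] := natS_le_expr c1.
have P20 : 0 <= (2 : R) `^ eps by exact: powR_ge0.
(* The 18 counts the square parts of a block, the 168 comes from the Farey spacing. *)
have [c c0 cE] : exists2 c : R, 0 < c & c = 18 * 168 by exists (18 * 168) => //; rewrite mulr_gt0 ?ltr0n.
exists (K0 * (2 * C1 + c * K0) * 2 `^ eps).
  by rewrite !mulr_gt0 ?powR_gt0 ?ltr0n ?addr_gt0 ?mulr_gt0 ?ltr0n.
move=> beta Q eta r s Q1 eta0 eta8 us hs.
have Q0 : 0 < Q := lt_le_trans ltr01 Q1.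
pose par q := xget (0%N, 0) [set p : nat * gaussInt | 2 * q = p.1%:R * p.2 ^+ 2].
pose m q := (par q).1; pose z q := (par q).2.
have s0 q : q \in s -> q != 0 by case/hs.
have sP q : q \in s -> 2 * q = (m q)%:R * z q ^+ 2.
  move=> /hs[_ _ [k /square_norm_param[m0 [z0 h]]] _ _].
  apply: (@xgetPex _ (0%N, 0) [set p : nat * gaussInt | 2 * q = p.1%:R * p.2 ^+ 2]).
  by exists (m0, z0).
have sC q : q \in s -> gauss_coprime (r q) q by case/hs.
have sE q : q \in s -> cabs (beta * gaussC R q - gaussC R (r q)) <= eta by case/hs.
have sQ q : q \in s -> (m q)%:R * cabs (gaussC R (z q)) ^+ 2 <= 2 * Q.
  move=> qs; have [_ nq _ _ _] := hs q qs.
  have -> : (m q)%:R * cabs (gaussC R (z q)) ^+ 2 = 2 * cabs (gaussC R q).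
    have e' : 2 * gaussC R q = (m q)%:R * gaussC R (z q) ^+ 2.
      have := congr1 (gaussC R) (sP q qs).
      by rewrite (gaussCM _ 2) (gaussCM _ _%:R) gaussCX !(rmorph_nat (gaussC R)).
    by rewrite -cabsX -[(m q)%:R]cabs_nat -cabsM -e' cabsM cabs_nat.
  rewrite ler_pM2l// -(@ler_pXn2r _ 2)// ?nnegrE ?cabs_ge0 ?(ltW Q0)//.
  by rewrite cabs_gaussC.
have m_gt0 := near_m_gt0 s0 sP.
have m_le q : q \in s -> (m q)%:R <= 2 * Q.
  move=> qs; apply: le_trans (sQ q qs); rewrite ler_peMr ?ler0n// exprn_ege1//.
  exact: (near_z_ge1 _ s0 sP).
pose n := trunc_log 2 (Num.truncn (2 * Q)).
have Qn : (0 < Num.truncn (2 * Q))%N by rewrite truncn_gt0; lra.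
have hn : 2 ^+ n <= 2 * Q.
  rewrite -natrX; apply: (@le_trans _ _ (Num.truncn (2 * Q))%:R).
    by rewrite ler_nat trunc_logP.
  by rewrite truncn_le; lra.
have jn q : q \in s -> (trunc_log 2 (m q) < n.+1)%N.
  move=> qs; rewrite ltnS leq_trunc_log//.
  by rewrite truncn_ge_nat ?m_le//; lra.
set K := n.+1.
have KK : K%:R <= K0 * (2 * Q) `^ e.
  apply: le_trans (hK0 n) _; rewrite ler_pM2l//.
  have -> : (2 `^ e) ^+ n = (2 ^+ n) `^ e :> R.
    elim: (n) => [|k IH]; first by rewrite !expr0 powR1.
    by rewrite !exprS powRM ?exprn_ge0// IH.
  by apply: ge0_ler_powR; rewrite ?nnegrE ?exprn_ge0 ?(ltW e_gt0)//; lra.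
set P := (2 * Q) `^ e in KK.
have P0 : 0 <= P := powR_ge0 _ _.
set S := Num.sqrt Q + Q * eta.
have S0 : 0 <= S by rewrite addr_ge0 ?sqrtr_ge0// mulr_ge0 ?ltW.
have QS : Q = Num.sqrt Q * Num.sqrt Q by rewrite -expr2 sqr_sqrtr// ltW.
have sQ0 : 0 < Num.sqrt Q by rewrite sqrtr_gt0.
have Qe0 : 0 <= Q * eta by rewrite mulr_ge0 ?ltW.
have K0' : 0 <= K%:R :> R by exact: ler0n.
have CP0 : 0 <= 2 * C1 * P + c * K%:R.
  by rewrite addr_ge0 ?mulr_ge0 ?ler0n ?(ltW C10) ?(ltW c0).
have block j : (j < K)%N -> forall t, uniq t -> {subset t <= s} ->
    (forall q, q \in t -> (2 ^ j <= m q < 2 ^ j.+1)%N) ->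
    (size t)%:R <= (2 * C1 * P + c * K%:R) * S.
  move=> jK t ut ts tm.
  have M0 : 0 < 2 ^+ j :> R by rewrite exprn_gt0.
  have [h|h] := leP (2 ^+ j) (Num.sqrt Q).
    apply: (@le_trans _ _ (2 ^+ j * (C1 * P * (1 + 2 * Q / 2 ^+ j * eta)))).
      have B0 : 0 <= C1 * P * (1 + 2 * Q / 2 ^+ j * eta).
        apply: mulr_ge0; first by rewrite mulr_ge0// ltW.
        by rewrite addr_ge0// !mulr_ge0 ?invr_ge0 ?ltW.
      apply: (size_near_block_multiplier ut B0 tm) => m0 hm0 u uu ut' um.
      have hm0' : 2 ^+ j <= m0%:R :> R by rewrite -natrX ler_nat.
      have us' : {subset u <= s} by move=> q /ut' /ts.
      have := size_near_fixed_multiplier Q1 eta0 eta8 s0 sP sC sE sQ (ltW C10) e_gt0 hC1 uu us' um.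
      move=> /le_trans; apply; apply: ler_wpM2l; first by rewrite mulr_ge0// ltW.
      rewrite lerD2l; apply: ler_wpM2r; first exact: ltW.
      apply: ler_wpM2l; first lra.
      by rewrite lef_pV2 ?posrE// (lt_le_trans M0).
    have -> : 2 ^+ j * (C1 * P * (1 + 2 * Q / 2 ^+ j * eta)) =
       C1 * P * (2 ^+ j + 2 * (Q * eta)) by field; rewrite gt_eqF.
    rewrite [leRHS]mulrDl; apply: (@le_trans _ _ (2 * C1 * P * S)); last first.
      by rewrite lerDl !mulr_ge0 ?(ltW c0).
    rewrite (_ : 2 * C1 * P * S = C1 * P * (2 * S)); last by ring.
    apply: ler_wpM2l; first by rewrite mulr_ge0 ?(ltW C10).
    by rewrite /S; lra.
  have := size_near_block_square Q1 eta0 eta8 s0 sP sC sE sQ ut ts tm jK.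
  move=> /le_trans; apply.
  have -> : 18 * Q / 2 ^+ j * (K%:R * (1 + 168 * (2 ^+ j * eta))) =
     K%:R * (18 * (Q / 2 ^+ j) + c * (Q * eta)) by rewrite cE; field; rewrite gt_eqF.
  have h1 : Q / 2 ^+ j <= Num.sqrt Q.
    by rewrite ler_pdivrMr// {1}QS ler_pM2l// ltW.
  rewrite [leRHS]mulrDl; apply: (@le_trans _ _ (c * K%:R * S)); last first.
    by rewrite lerDr !mulr_ge0 ?(ltW C10).
  rewrite (_ : c * K%:R * S = K%:R * (c * S)); last by ring.
  apply: ler_wpM2l => //; rewrite /S mulrDr lerD2r.
  have c18 : 18 <= c by rewrite cE; lra.
  by apply: ler_pM; rewrite ?divr_ge0 ?(ltW Q0) ?(ltW M0) ?ler0n.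
apply: (@le_trans _ _ (K%:R * ((2 * C1 * P + c * K%:R) * S))).
  apply: (size_fibers (f := fun q => trunc_log 2 (m q))).
  - by rewrite mulr_ge0.
  - rewrite ler_nat -[leqRHS](size_iota 0 K); apply: uniq_leq_size; first exact: undup_uniq.
    by move=> j; rewrite mem_undup => /mapP[q /jn h ->]; rewrite mem_iota.
  move=> j; case E : [seq q <- s | trunc_log 2 (m q) == j] => [|q0 u0].
    by rewrite mulr_ge0.
  rewrite -E; apply: (block j); rewrite ?filter_uniq//.
  - have : q0 \in [seq q <- s | trunc_log 2 (m q) == j] by rewrite E mem_head.
    by rewrite mem_filter => /andP[/eqP <- /jn].
  - by move=> q; rewrite mem_filter => /andP[].
  move=> q; rewrite mem_filter => /andP[/eqP <- qs].
  by rewrite trunc_logP ?m_gt0//= trunc_log_ltn.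
rewrite mulrA; apply: ler_wpM2r => //.
have -> : K0 * (2 * C1 + c * K0) * 2 `^ eps * Q `^ eps =
   (K0 * P) * (2 * C1 * P + c * (K0 * P)).
  have PP : 2 `^ eps * Q `^ eps = P * P.
    rewrite -powRM ?(ltW Q0)// /P -powRD; last by rewrite mulf_neq0 ?implybT// ?gt_eqF.
    by congr (_ `^ _); rewrite /e; field.
  by rewrite -mulrA PP; ring.
apply: ler_pM => //.
by rewrite lerD2l ler_pM2l.
Qed.

(** * The large sieve *)

Section Exponential.
Variable R : realType.
Implicit Types (x y t : R).

Definition uexp (x : R) : R[i] := (cos (2 * pi * x) +i* sin (2 * pi * x))%C.

Lemma uexpD x y : uexp (x + y) = uexp x * uexp y.
Proof.
apply/eqP; rewrite eq_complex /uexp mulrDr cosD sinD /=.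
by rewrite [X in _ && (_ == X)]addrC !eqxx.
Qed.

Lemma uexp0 : uexp 0 = 1.
Proof. by rewrite /uexp mulr0 cos0 sin0. Qed.

Lemma cabs_uexp x : cabs (uexp x) = 1.
Proof. by rewrite /cabs /uexp /= cos2Dsin2 sqrtr1. Qed.

Lemma conjc_uexp x : ((uexp x)^*)%C = uexp (- x).
Proof. by rewrite /uexp mulrN cosN sinN. Qed.

Lemma uexpMn x n : uexp (n%:R * x) = uexp x ^+ n.
Proof.
elim: n => [|n IH]; first by rewrite mul0r uexp0 expr0.
by rewrite -natr1 mulrDl mul1r uexpD IH exprSr.
Qed.

Lemma uexp_nat n : uexp n%:R = 1.
Proof.
rewrite -[n%:R]mulr1 uexpMn (_ : uexp 1 = 1) ?expr1n//.
by rewrite /uexp mulr1 mulr_natl cos2pi sin2pi.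
Qed.

Lemma uexp_int (k : int) : uexp k%:~R = 1.
Proof.
case: k => n; first exact: uexp_nat.
by rewrite NegzE intrN -conjc_uexp uexp_nat conjc1.
Qed.

Lemma uexpDint x (k : int) : uexp (x + k%:~R) = uexp x.
Proof. by rewrite uexpD uexp_int mulr1. Qed.

(** By the mean value theorem [sin y = y cos c] with [c <= y], and cosine decreases on [[0, pi]]. *)
Lemma sin_ge_mul_cos y : 0 <= y <= pi -> y * cos y <= sin y.
Proof.
move=> /andP[y0 ypi].
have [|c cy] := @MVT_segment R sin cos 0 y y0.
  by apply: derivable_within_continuous => z _; exact: derivable_sin.
rewrite sin0 !subr0 => ->; rewrite mulrC; apply: ler_wpM2r => //.
move: cy; rewrite in_itv /= => /andP[c0 cy].
rewrite leNgt ltr_cos ?in_itv /= ?y0 ?c0 ?ypi ?(le_trans cy)//.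
by rewrite -leNgt.
Qed.

(** With [y = x / 2], [sin x = 2 sin y cos y >= 2 y cos^2 y], and [cos x >= 0] says that
    [2 cos^2 y >= 1]. *)
Lemma sin_ge_half x : 0 <= x <= pi / 2 -> x / 2 <= sin x.
Proof.
move=> /andP[x0 xpi]; have p0 := pi_gt0 R.
pose y := x / 2; have xE : x = y *+ 2 by rewrite /y -mulr_natr divfK.
have y0 : 0 <= y by rewrite /y; lra.
have hc : 0 <= cos y by apply: cos_ge0_pihalf; rewrite /y; lra.
have hs : y * cos y <= sin y by apply: sin_ge_mul_cos; rewrite /y; lra.
have h2 : 0 <= cos x by apply: cos_ge0_pihalf; lra.
rewrite -/y [in sin _]xE sin_mulr2n; move: h2; rewrite xE cos_mulr2n.
have := ler_wpM2l hc hs => h1 h3.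
by have := mulr_ge0 y0 h3; rewrite !mulr2n in h3 *; lra.
Qed.

(** The right-hand side is [2 |sin (pi x)|], and [sin (pi x) >= pi x / 2 >= x] for
    [0 <= x <= 1/2]. *)
Lemma cabs_one_sub_uexp x : `|x| <= 2^-1 -> 2 * `|x| <= cabs (1 - uexp x).
Proof.
move=> hx.
wlog x0 : x hx / 0 <= x.
  move=> h; have [x0|x0] := leP 0 x; first exact: h.
  have := h (- x); rewrite normrN => /(_ hx); rewrite oppr_ge0 ltW// => /(_ isT).
  rewrite -conjc_uexp => /le_trans; apply.
  by rewrite /cabs; case: (uexp x) => a b /=; rewrite !add0r opprK sqrrN.
rewrite ger0_norm// in hx *.
rewrite -(@ler_pXn2r _ 2)// ?nnegrE ?cabs_ge0 ?mulr_ge0// cabs_sqr /=.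
rewrite sub0r sqrrN; set c := cos _; set s := sin _.
have cs : c ^+ 2 + s ^+ 2 = 1 := cos2Dsin2 _.
have cE : c = 1 - (sin (pi * x) ^+ 2) *+ 2.
  by rewrite /c -mulrA mulr_natl cos_mulr2n cos2sin2 !mulr2n; ring.
have p2 := pi_ge2 R.
have h : x <= sin (pi * x).
  apply: le_trans (sin_ge_half _); first by nra.
  by apply/andP; split; nra.
have : x ^+ 2 <= sin (pi * x) ^+ 2 by rewrite lerXn2r ?nnegrE// (le_trans x0 h).
by move: cE; rewrite mulr2n; nra.
Qed.

(** * Dirichlet kernels and their product *)

Definition dirichlet n x : R[i] := \sum_(p < n) uexp (p%:R * x).

Lemma cabs_sum (T : Type) (s : seq T) (P : pred T) (F : T -> R[i]) :
  cabs (\sum_(i <- s | P i) F i) <= \sum_(i <- s | P i) cabs (F i).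
Proof.
elim/big_ind2: _ => [|a b c d h1 h2|//]; first by rewrite cabs0.
by apply: le_trans (cabsD _ _) _; apply: lerD.
Qed.

Lemma cabs_dirichlet n x : cabs (dirichlet n x) <= n%:R.
Proof.
apply: le_trans (cabs_sum _ _ _) _.
by under eq_bigr do rewrite cabs_uexp; rewrite sumr_const card_ord.
Qed.

Lemma dirichlet_geometric n x : cabs (dirichlet n x) * cabs (1 - uexp x) <= 2.
Proof.
have -> : dirichlet n x = \sum_(p < n) uexp x ^+ p.
  by apply: eq_bigr => p _; rewrite uexpMn.
rewrite -cabsM mulrC -cabsN -mulNr opprB -subrX1.
apply: le_trans (cabsB _ _) _.
by rewrite cabsX cabs_uexp expr1n cabs1; lra.
Qed.

(* Every frequency [j < J] is attained [J] times as a difference [t.2 - t.1]. *)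
Definition fejer J x : R[i] :=
  \sum_(t : 'I_J * 'I_(2 * J)) uexp ((t.2%:R - t.1%:R) * x).

Lemma fejerE J x : fejer J x = dirichlet J (- x) * dirichlet (2 * J) x.
Proof.
rewrite /dirichlet big_distrlr /= pair_bigA /=; apply: eq_bigr => t _.
by rewrite -uexpD; congr uexp; ring.
Qed.

Lemma fejerN J x : cabs (fejer J (- x)) = cabs (fejer J x).
Proof.
have -> : fejer J (- x) = ((fejer J x)^*)%C.
  transitivity (\sum_(t : 'I_J * 'I_(2 * J)) ((uexp ((t.2%:R - t.1%:R) * x))^*)%C).
    by apply: eq_bigr => t _; rewrite conjc_uexp mulrN.
  by rewrite /fejer rmorph_sum.
by rewrite /cabs; case: (fejer J x) => a b /=; rewrite sqrrN.
Qed.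

(** The product of the two Dirichlet kernels is at most [2 J^2] trivially and at most [1 / y^2] by
    summing geometric series. As the floor [k] of [v = J y] satisfies [1 + k^2 <= 3 + 2 v^2], the
    constant is [3 * 2 + 2 = 8]. The floor is the index of a cell of side [1 / J]. *)
Lemma cabs_fejer J x (n : int) : `|x - n%:~R| <= 2^-1 ->
  cabs (fejer J x) * (1 + (Num.floor (J%:R * (x - n%:~R)))%:~R ^+ 2) <= 8 * J%:R ^+ 2.
Proof.
move=> hx; set y := x - n%:~R in hx *; set v := J%:R * y; set k := Num.floor v.
have uE : uexp x = uexp y by rewrite -(uexpDint y n) /y subrK.
have uE' : uexp (- x) = uexp (- y) by rewrite -!conjc_uexp uE.
have b (z : R) N : uexp z = uexp y \/ uexp z = uexp (- y) -> cabs (dirichlet N z) * `|y| <= 1.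
  move=> hz; have h1 := dirichlet_geometric N z.
  have h2 : 2 * `|y| <= cabs (1 - uexp z).
    case: hz => ->; first exact: cabs_one_sub_uexp.
    by rewrite -normrN; apply: cabs_one_sub_uexp; rewrite normrN.
  have := ler_wpM2l (cabs_ge0 (dirichlet N z)) h2; lra.
rewrite fejerE cabsM.
have b1 := b (- x) J (or_intror uE'); have b2 := b x (2 * J)%N (or_introl uE).
have c1 := cabs_dirichlet J (- x); have c2 := cabs_dirichlet (2 * J) x.
move: (cabs_ge0 (dirichlet J (- x))) (cabs_ge0 (dirichlet (2 * J) x)) b1 b2 c1 c2.
rewrite natrM; move: (cabs (dirichlet J (- x))) (cabs (dirichlet (2 * J) x)) => d1 d2 d10 d20 b1 b2 c1 c2.
have hk : k%:~R ^+ 2 <= 2 * v ^+ 2 + 2.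
  have := Num.Theory.floor_le v; have := floorD1_gt v; rewrite intrD -/k => ? ?.
  have := sqr_ge0 (v - 1); have := sqr_ge0 (v + 1); nra.
have J0 : 0 <= J%:R :> R by exact: ler0n.
have e1 : d1 * d2 <= 2 * J%:R ^+ 2.
  have := ler_pM d10 d20 c1 c2; nra.
have e2 : d1 * d2 * v ^+ 2 <= J%:R ^+ 2.
  have := ler_pM (mulr_ge0 d10 (normr_ge0 y)) (mulr_ge0 d20 (normr_ge0 y)) b1 b2.
  rewrite mulr1 => e; have : d1 * d2 * y ^+ 2 <= 1.
    by rewrite -(real_normK (num_real y)); lra.
  move=> /(ler_wpM2l (sqr_ge0 J%:R)); rewrite /v exprMn; lra.
have d0 : 0 <= d1 * d2 by exact: mulr_ge0.
have := ler_wpM2l d0 hk; lra.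
Qed.

End Exponential.

(** * The dual inequality *)

Lemma ler_sum_shift (R : realType) (J : nat) (h : R -> R) : (forall t, 0 <= h t) ->
  J%:R * (\sum_(j < J) h j%:R) <=
  \sum_(t : 'I_J * 'I_(2 * J)) h (t.2%:R - t.1%:R).
Proof.
move=> h0; rewrite -(pair_bigA _ (fun (p' : 'I_J) (p : 'I_(2 * J)) => h (p%:R - p'%:R))) /=.
have -> : J%:R * (\sum_(j < J) h j%:R) = \sum_(p' < J) \sum_(j < J) h j%:R.
  by rewrite sumr_const card_ord mulr_natl.
apply: ler_sum => p' _; have pJ := ltn_ord p'.
rewrite -(big_mkord xpredT (fun p => h (p%:R - p'%:R))).
(* For [p' < J] the indices from [p'] to [p' + J - 1] stay below [2 J], which is why the two lengths
   differ; the remaining terms are nonnegative. *)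
rewrite (@big_cat_nat _ _ _ p')//=; last lia.
rewrite [X in _ <= _ + X](@big_cat_nat _ _ _ (p' + J))//=; [|lia|lia].
have -> : \sum_(p' <= i < p' + J) h (i%:R - p'%:R) = \sum_(j < J) h j%:R.
  rewrite -{1}[nat_of_ord p']add0n big_addn addKn big_mkord.
  by apply: eq_bigr => j _; rewrite natrD addrK.
by rewrite addrCA lerDl addr_ge0// sumr_ge0.
Qed.

Lemma cabs_sqrC (R : realType) (z : R[i]) : ((cabs z ^+ 2)%:C = z * z^*)%C.
Proof.
rewrite cabs_sqr; case: z => a b; apply/eqP; rewrite eq_complex /=.
by apply/andP; split; apply/eqP; ring.
Qed.

(** Averaging over shifted frequencies only enlarges the sum and, after expanding the square, turns
    the sums over frequencies into kernels. Then [2 |c c'| <= |c|^2 + |c'|^2] and the symmetry of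
    the kernels reduce everything to a row sum, as in Schur's test. *)
Lemma large_sieve_dual (R : realType) (I : eqType) (s : seq I) (x y : I -> R)
    (c : I -> R[i]) (J : nat) (W : R) :
  (forall u v, \sum_(i <- s) cabs (fejer J (x i - u)) * cabs (fejer J (y i - v)) <= W) ->
  J%:R ^+ 2 * (\sum_(j < J) \sum_(l < J)
    cabs (\sum_(i <- s) c i * uexp (j%:R * x i + l%:R * y i)) ^+ 2) <=
  W * \sum_(i <- s) cabs (c i) ^+ 2.
Proof.
move=> hW.
pose G t1 t2 : R[i] := \sum_(i <- s) c i * uexp (t1 * x i + t2 * y i).
pose H t1 t2 := cabs (G t1 t2) ^+ 2.
have H0 t1 t2 : 0 <= H t1 t2 by exact: sqr_ge0.
pose T : finType := ('I_J * 'I_(2 * J))%type.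
pose d (t : T) : R := t.2%:R - t.1%:R.
pose S := \sum_(t : T) \sum_(t' : T) H (d t) (d t').
apply: (@le_trans _ _ S).
  apply: le_trans (@ler_sum_shift R J (fun t => \sum_(t' : T) H t (d t')) _); last first.
    by move=> t; apply: sumr_ge0.
  rewrite expr2 -mulrA; apply: ler_wpM2l; first exact: ler0n.
  rewrite mulr_sumr; apply: ler_sum => j _.
  exact: (@ler_sum_shift R J (fun t => H j%:R t)).
pose P := [seq (i, i') | i <- s, i' <- s].
pose w (u : I * I) := cabs (fejer J (x u.1 - x u.2)) * cabs (fejer J (y u.1 - y u.2)).
have w0 u : 0 <= w u by rewrite mulr_ge0 ?cabs_ge0.
have HE t1 t2 : ((H t1 t2)%:C)%C = \sum_(u <- P) c u.1 * ((c u.2)^*)%C *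
    (uexp (t1 * (x u.1 - x u.2)) * uexp (t2 * (y u.1 - y u.2))).
  rewrite /H cabs_sqrC /G (rmorph_sum (@conjc R)) /= big_distrlr /= /P big_allpairs /=.
  apply: eq_bigr => i _; apply: eq_bigr => i' _.
  have -> : ((c i' * uexp (t1 * x i' + t2 * y i'))^*)%C =
      ((c i')^*)%C * uexp (- (t1 * x i' + t2 * y i')).
    by rewrite -conjc_uexp; exact: rmorphM.
  rewrite mulrACA -uexpD -uexpD.
  by congr (_ * uexp _); ring.
have SE : (S%:C)%C = \sum_(u <- P) c u.1 * ((c u.2)^*)%C *
    (fejer J (x u.1 - x u.2) * fejer J (y u.1 - y u.2)).
  rewrite /S pair_bigA /= rmorph_sum /=.
  under eq_bigr do rewrite HE.
  rewrite exchange_big /=; apply: eq_bigr => u _.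
  by rewrite -mulr_sumr /fejer big_distrlr /= pair_bigA.
have S0 : 0 <= S by apply: sumr_ge0 => t _; apply: sumr_ge0.
have -> : S = cabs ((S%:C)%C) by rewrite cabs_real ger0_norm.
rewrite SE; apply: le_trans (cabs_sum _ _ _) _.
apply: (@le_trans _ _ (\sum_(u <- P)
   (cabs (c u.1) ^+ 2 * w u / 2 + cabs (c u.2) ^+ 2 * w u / 2))).
  apply: ler_sum => u _; rewrite !cabsM (_ : cabs ((c u.2)^*)%C = cabs (c u.2)); last first.
    by rewrite /cabs; case: (c u.2) => a b /=; rewrite sqrrN.
  rewrite -/(w u); have := w0 u.
  move: (cabs (c u.1)) (cabs (c u.2)) (w u) => a b r r0.
  by have := mulr_ge0 r0 (sqr_ge0 (a - b)); lra.
rewrite big_split /= /P !big_allpairs /=.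
have half : W * \sum_(i <- s) cabs (c i) ^+ 2 =
    \sum_(i <- s) cabs (c i) ^+ 2 * W / 2 + \sum_(i <- s) cabs (c i) ^+ 2 * W / 2.
  by rewrite -big_split /= mulr_sumr; apply: eq_bigr => i _; field.
rewrite half; apply: lerD.
  apply: ler_sum => i _; rewrite -mulr_suml -mulr_sumr.
  apply: ler_wpM2r; first by rewrite invr_ge0.
  apply: ler_wpM2l; first exact: sqr_ge0.
  apply: le_trans (hW (x i) (y i)); apply: ler_sum => i' _.
  by rewrite /w /= -[x i - _]opprB -[y i - _]opprB !fejerN.
rewrite exchange_big /=; apply: ler_sum => i _; rewrite -mulr_suml -mulr_sumr.
apply: ler_wpM2r; first by rewrite invr_ge0.
apply: ler_wpM2l; first exact: sqr_ge0.
exact: (hW (x i) (y i)).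
Qed.

(** * Summation over cells and the large sieve *)

Lemma sum_inv_sqr (R : realType) (n : nat) :
  \sum_(k <- iota 0 n.+1) (1 + k%:R ^+ 2)^-1 <= 3 - 2 / n.+1%:R :> R.
Proof.
elim: n => [|n IH].
  by rewrite /= big_seq1 expr0n addr0 invr1; lra.
rewrite -addn1 iotaD big_cat /= big_seq1 add0n.
apply: le_trans (lerD IH (lexx _)) _.
have n0 : 0 <= n%:R :> R by exact: ler0n.
rewrite addn1 -!natr1; set m : R := n%:R in n0 *.
(* The comparison term telescopes, which explains the shape [3 - 2 / (n + 1)] of the bound. *)
have : (1 + (m + 1) ^+ 2)^-1 <= 2 / ((m + 1) * (m + 1 + 1)).
  rewrite -[leRHS]invf_div lef_pV2 ?posrE; [nra|nra|].
  by rewrite divr_gt0// mulr_gt0; lra.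
have -> : 2 / ((m + 1) * (m + 1 + 1)) = 2 / (m + 1) - 2 / (m + 1 + 1).
  by field; rewrite !gt_eqF; lra.
lra.
Qed.

(** The integers from [- J] to [J]; [Negz k] is [- (k + 1)], so the second list is one shorter. *)
Definition int_window (J : nat) : seq int :=
  [seq Posz k | k <- iota 0 J.+1] ++ [seq Negz k | k <- iota 0 J].

Lemma int_window_uniq J : uniq (int_window J).
Proof.
rewrite cat_uniq !map_inj_uniq ?iota_uniq //=; [|by move=> ? ? []..].
by rewrite andbT; apply/hasPn => _ /mapP[k _ ->]; apply/mapP => -[].
Qed.

Lemma mem_int_window (J : nat) (k : int) : - J%:Z <= k <= J%:Z -> k \in int_window J.
Proof.
case: k => k /andP[h1 h2]; rewrite mem_cat; apply/orP.
  by left; apply/mapP; exists k => //; rewrite mem_iota; lia.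
by right; apply/mapP; exists k => //; rewrite mem_iota; lia.
Qed.

Lemma sum_int_window (R : realType) J :
  \sum_(k <- int_window J) (1 + k%:~R ^+ 2)^-1 <= 6 :> R.
Proof.
rewrite big_cat !big_map.
have h n : \sum_(k <- iota 0 n.+1) (1 + k%:R ^+ 2)^-1 <= 3 :> R.
  apply: le_trans (sum_inv_sqr R n) _.
  by rewrite gerBl divr_ge0.
have -> : 6 = 3 + 3 :> R by ring.
apply: lerD; first exact: h.
apply: le_trans (h J); rewrite -[in leRHS]addn1 iotaD big_cat /= -[leLHS]addr0.
apply: lerD; last by rewrite big_seq1 invr_ge0 addr_ge0// sqr_ge0.
apply: ler_sum => k _; rewrite lef_pV2 ?posrE ?ltr_pwDl ?sqr_ge0//.
rewrite NegzE intrN sqrrN lerD2l lerXn2r ?nnegrE ?ler0n//.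
by rewrite ler_nat.
Qed.

(** The points are sorted by their cell relative to [(u, v)] modulo 1. In the cell [(k, l)] the
    kernels decay like [1 / ((1 + k^2) (1 + l^2))], a weight with bounded sum, and no cell holds
    more than [B] points. *)
Lemma sum_fejer_le (R : realType) (I : eqType) (s : seq I) (x y : I -> R)
    (J : nat) (B : R) : (0 < J)%N -> 0 <= B ->
  (forall u v : R, (size [seq i <- s | `[< exists k l : int,
      u <= x i - k%:~R < u + J%:R^-1 /\ v <= y i - l%:~R < v + J%:R^-1 >]])%:R <= B) ->
  forall u v,
  \sum_(i <- s) cabs (fejer J (x i - u)) * cabs (fejer J (y i - v)) <=
  (8 * J%:R ^+ 2) ^+ 2 * (6 ^+ 2 * B).
Proof.
move=> J0 B0 hB u v; have J0' : 0 < J%:R :> R by rewrite ltr0n.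
pose w (k : int) : R := (1 + k%:~R ^+ 2)^-1.
have w0 k : 0 <= w k by rewrite invr_ge0 addr_ge0 ?sqr_ge0.
(* Reducing by a nearest integer leaves at most 1/2 in absolute value, so cell indices stay in the
   window. *)
pose near (t : R) := Num.floor (t + 2^-1).
have nearP t : `|t - (near t)%:~R| <= 2^-1.
  have := Num.Theory.floor_le (t + 2^-1); have := floorD1_gt (t + 2^-1).
  by rewrite intrD ler_norml -/(near t) => ? ?; apply/andP; split; lra.
pose kk (t : R) := Num.floor (J%:R * (t - (near t)%:~R)).
have kkL t : kk t \in int_window J.
  have := nearP t; rewrite ler_norml => /andP[h1 h2]; apply: mem_int_window.
  have hj : - J%:R <= J%:R * (t - (near t)%:~R) <= J%:R by apply/andP; split; nra.
  case/andP: hj => h3 h4; apply/andP; split.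
    by rewrite floor_ge_int intrN.
  by rewrite -(ler_int R); apply: le_trans (Num.Theory.floor_le _) h4.
have fB t : cabs (fejer J t) <= 8 * J%:R ^+ 2 * w (kk t).
  rewrite ler_pdivlMr; last by rewrite ltr_pwDl ?sqr_ge0.
  exact: cabs_fejer.
have kcell t (k : int) : kk t = k ->
    k%:~R / J%:R <= t - (near t)%:~R < k%:~R / J%:R + J%:R^-1.
  move=> <-; have := Num.Theory.floor_le (J%:R * (t - (near t)%:~R)).
  have := floorD1_gt (J%:R * (t - (near t)%:~R)); rewrite intrD -/(kk t) => h1 h2.
  rewrite ler_pdivrMr// [_ * J%:R]mulrC h2 /=.
  have -> : (kk t)%:~R / J%:R + J%:R^-1 = ((kk t)%:~R + 1) / J%:R :> R.
    by rewrite mulrDl mul1r.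
  by rewrite ltr_pdivlMr// mulrC.
apply: (@le_trans _ _ (\sum_(i <- s) (8 * J%:R ^+ 2) ^+ 2 * (w (kk (x i - u)) * w (kk (y i - v))))).
  apply: ler_sum => i _.
  apply: le_trans (ler_pM (cabs_ge0 _) (cabs_ge0 _) (fB _) (fB _)) _.
  by rewrite mulrACA -expr2.
rewrite -mulr_sumr; apply: ler_wpM2l; first exact: sqr_ge0.
have wE t : w (kk t) = \sum_(k <- int_window J) w k * (kk t == k)%:R.
  rewrite (bigD1_seq (kk t)) ?int_window_uniq//= eqxx mulr1 big1 ?addr0// => k hk.
  by rewrite eq_sym (negbTE hk) mulr0.
have -> : \sum_(i <- s) w (kk (x i - u)) * w (kk (y i - v)) =
  \sum_(k <- int_window J) \sum_(l <- int_window J)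
    w k * w l * (size [seq i <- s | (kk (x i - u) == k) && (kk (y i - v) == l)])%:R.
  under eq_bigr => i _ do rewrite wE [X in _ * X]wE big_distrlr /=.
  rewrite exchange_big /=; apply: eq_bigr => k _.
  rewrite exchange_big /=; apply: eq_bigr => l _.
  rewrite size_filter -sum1_count natr_sum [in RHS]big_mkcond /= mulr_sumr.
  apply: eq_bigr => i _; rewrite mulrACA.
  by case: (kk (x i - u) == k); case: (kk (y i - v) == l); rewrite /= ?mulr1 ?mulr0 ?mul0r.
apply: (@le_trans _ _ (\sum_(k <- int_window J) \sum_(l <- int_window J) w k * w l * B)).
  apply: ler_sum => k _; apply: ler_sum => l _.
  apply: ler_wpM2l; first exact: mulr_ge0.
  apply: le_trans (hB (u + k%:~R / J%:R) (v + l%:~R / J%:R)).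
  rewrite ler_nat !size_filter; apply: sub_count => i /andP[/eqP /kcell h1 /eqP /kcell h2].
  apply/asboolP; exists (near (x i - u)), (near (y i - v)).
  by move: h1 h2 => /andP[? ?] /andP[? ?]; split; apply/andP; split; lra.
under eq_bigr => k _ do rewrite -mulr_suml.
rewrite -mulr_suml; apply: ler_wpM2r => //.
rewrite -big_distrlr /= -expr2 lerXn2r ?nnegrE ?sum_int_window//.
by apply: sumr_ge0.
Qed.

(** Duality: the left-hand side [T] is the pairing of [a] with the dual sums [g] whose coefficients
    are the conjugates of [f]. A weighted arithmetic-geometric mean inequality and the dual bound
    for [g] give [T <= (b A + T) / 2]. *)
Lemma large_sieve (R : realType) : exists2 C : R, 0 < C &
  forall (I : eqType) (s : seq I) (x y : I -> R) (J : nat) (B : R)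
    (a : nat -> nat -> R[i]), (0 < J)%N -> 0 < B ->
  (forall u v : R, (size [seq i <- s | `[< exists k l : int,
      u <= x i - k%:~R < u + J%:R^-1 /\ v <= y i - l%:~R < v + J%:R^-1 >]])%:R <= B) ->
  \sum_(i <- s) cabs (\sum_(j < J) \sum_(l < J) a j l * uexp (j%:R * x i + l%:R * y i)) ^+ 2
  <= C * J%:R ^+ 2 * B * \sum_(j < J) \sum_(l < J) cabs (a j l) ^+ 2.
Proof.
(* The dual weight is [(8 J^2)^2 * 6^2 * B], of which a factor [J^2] cancels. *)
have [C C0 CE] : exists2 C : R, 0 < C & C = (8 * 6) ^+ 2.
  by exists ((8 * 6) ^+ 2) => //; rewrite exprn_gt0 ?mulr_gt0.
exists C => // I s x y J B a J0 B0 hB.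
have J0' : 0 < J%:R :> R by rewrite ltr0n.
pose f i := \sum_(j < J) \sum_(l < J) a j l * uexp (j%:R * x i + l%:R * y i).
pose g (j l : 'I_J) := \sum_(i <- s) ((f i)^*)%C * uexp (j%:R * x i + l%:R * y i).
pose T := \sum_(i <- s) cabs (f i) ^+ 2.
pose A := \sum_(j < J) \sum_(l < J) cabs (a j l) ^+ 2.
pose b := C * J%:R ^+ 2 * B.
have b0 : 0 < b by rewrite !mulr_gt0 ?exprn_gt0.
rewrite -/T -/A -/b.
have cabsJ z : cabs ((z : R[i])^*)%C = cabs z by case: z => c d; rewrite /cabs /= sqrrN.
have hg : \sum_(j < J) \sum_(l < J) cabs (g j l) ^+ 2 <= b * T.
  have := large_sieve_dual (fun i => ((f i)^*)%C) (sum_fejer_le J0 (ltW B0) hB).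
  rewrite (eq_bigr (fun i => cabs (f i) ^+ 2)); last by move=> i _; rewrite cabsJ.
  rewrite -/T (_ : (8 * J%:R ^+ 2) ^+ 2 * (6 ^+ 2 * B) * T = J%:R ^+ 2 * (b * T)); last first.
    by rewrite /b CE; ring.
  by rewrite ler_pM2l ?exprn_gt0.
have TE : (T%:C)%C = \sum_(j < J) \sum_(l < J) a j l * g j l.
  rewrite /T rmorph_sum /=.
  under eq_bigr => i _ do rewrite cabs_sqrC mulrC {2}/f mulr_sumr.
  rewrite exchange_big /=; apply: eq_bigr => j _.
  under eq_bigr => i _ do rewrite mulr_sumr.
  rewrite exchange_big /=; apply: eq_bigr => l _.
  by rewrite /g mulr_sumr; apply: eq_bigr => i _; rewrite mulrCA.
have T0 : 0 <= T by apply: sumr_ge0 => i _; exact: sqr_ge0.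
suff : T <= (b * A + T) / 2 by lra.
have {1}-> : T = cabs ((T%:C)%C) by rewrite cabs_real ger0_norm.
rewrite TE; apply: le_trans (cabs_sum _ _ _) _.
apply: (@le_trans _ _ (\sum_(j < J) \sum_(l < J)
   (b * cabs (a j l) ^+ 2 + cabs (g j l) ^+ 2 / b) / 2)).
  apply: ler_sum => j _; apply: le_trans (cabs_sum _ _ _) _.
  apply: ler_sum => l _; rewrite cabsM; move: (cabs (a j l)) (cabs (g j l)) => p q.
  have -> : b * p ^+ 2 + q ^+ 2 / b = (b * p - q) ^+ 2 / b + 2 * (p * q) by field; rewrite gt_eqF.
  have : 0 <= (b * p - q) ^+ 2 / b by rewrite divr_ge0 ?sqr_ge0 ?(ltW b0).
  lra.
under eq_bigr => j _ do rewrite -mulr_suml big_split /= -mulr_sumr -mulr_suml.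
rewrite -mulr_suml big_split /= -mulr_sumr -mulr_suml -/A.
apply: ler_wpM2r; first by rewrite invr_ge0.
by rewrite lerD2l ler_pdivrMr// mulrC.
Qed.

(** * Square norm moduli *)

(** The large sieve is stated for lists; this places the lists behind the finite sums inside their
    index sets. *)
Lemma finite_support_sub (T : Type) (I : choiceType) (idx : T) (D : set I) (F : I -> T) i :
  i \in finite_support idx D F -> D i.
Proof. by case: finite_supportP => // X XD _ _ /XD. Qed.

Lemma gauss_box_uniq n : uniq (gauss_box n).
Proof.
have ul : uniq [seq k%:Z - n%:Z | k <- iota 0 (n + n).+1].
  by rewrite map_inj_uniq ?iota_uniq// => ? ? /addIr [].
by apply: (allpairs_uniq ul ul) => -[a b] [c d] _ _ [-> ->].
Qed.

(** The large sieve takes natural numbers as frequencies, so the disc is placed in a square that is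
    translated by [K] in both directions. *)
Lemma fsbig_gauss_disc (R : realType) (V : nmodType) (N : R) (K : nat)
    (G : gaussInt -> V) : Num.sqrt N <= K%:R ->
  \sum_(n \in [set n : gaussInt | (gauss_norm n)%:~R <= N]) G n =
  \sum_(j < (K + K).+1) \sum_(l < (K + K).+1)
    let n := GaussInt (j%:Z - K%:Z) (l%:Z - K%:Z) in
    if (gauss_norm n)%:~R <= N then G n else 0.
Proof.
move=> NK.
rewrite (fsbigE [seq n <- gauss_box K | (gauss_norm n)%:~R <= N]).
- rewrite big_filter_cond (eq_bigl (fun n => (gauss_norm n)%:~R <= N)); last first.
    by move=> n /=; apply/andP/idP => [[]//|h]; rewrite inE.
  rewrite big_mkcond /gauss_box big_allpairs_dep big_map.
  rewrite -[iota _ _]/(index_iota 0 (K + K).+1) big_mkord; apply: eq_bigr => j _.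
  by rewrite big_map big_mkord.
- by rewrite filter_uniq// gauss_box_uniq.
- move=> n h; have : n \in [seq n <- gauss_box K | (gauss_norm n)%:~R <= N] := h.
  by rewrite mem_filter => /andP[].
move=> n nN; rewrite mem_filter.
have {}nN : (gauss_norm n)%:~R <= N := nN; rewrite nN => /negP[] /=.
have N0 : 0 <= N by apply: le_trans nN; rewrite ler0z gauss_norm_ge0.
have hn : cabs (gaussC R n) <= K%:R.
  apply: le_trans NK; rewrite -(@ler_pXn2r _ 2)// ?nnegrE ?cabs_ge0 ?sqrtr_ge0//.
  by rewrite cabs_gaussC sqr_sqrtr.
apply: mem_gauss_box; rewrite -(ler_int R) intr_norm.
  by apply: le_trans hn; exact: cabs_gauss_Re.
by apply: le_trans hn; exact: cabs_gauss_Im.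
Qed.

Lemma eC_real (R : realType) (t : R) : eC (t%:C)%C = uexp t.
Proof.
rewrite /eC /cexp /uexp /=.
rewrite !mulr0 !mul0r !mulr1 !subr0 !addr0 ?add0r ?mul0r ?subrr expR0.
by rewrite mul1r.
Qed.

Lemma cTr_half (R : realType) (z : R[i]) : cTr (z / 2) = ((complex.Re z)%:C)%C.
Proof.
rewrite /cTr -[((z / 2)^*)%R]/(((z / 2)^*)%C).
have -> : ((z / 2)^*)%C = (z^*)%C / 2.
  rewrite (_ : ((z / 2)^*)%C = (z^*)%C * ((2^-1)^*)%C); last exact: rmorphM.
  by rewrite conjc_inv (conjc_nat _ 2).
rewrite -mulrDl; apply: (mulIf (_ : 2 != 0)); first by rewrite pnatr_eq0.
rewrite divfK ?pnatr_eq0// mulr_natr mulr2n; case: z => a b.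
by apply/eqP; rewrite eq_complex /= subrr addr0 !eqxx.
Qed.

(** As [Tr (w / 2) = Re w], the phase is linear in the two coordinates of [n]; the minus sign of the
    real part of a product goes into the second coordinate of the point. *)
Lemma phase_uexp (R : realType) (n r q : gaussInt) :
  eC (cTr (gaussC R n * gaussC R r / (2 * gaussC R q))) =
  uexp ((gauss_re n)%:~R * complex.Re (gaussC R r / gaussC R q) +
        (gauss_im n)%:~R * - complex.Im (gaussC R r / gaussC R q)).
Proof.
have -> : gaussC R n * gaussC R r / (2 * gaussC R q) =
   gaussC R n * (gaussC R r / gaussC R q) / 2.
  by rewrite invfM mulrA mulrAC -!mulrA [gaussC R r * (_ * _)]mulrCA mulrC; ring.
rewrite cTr_half eC_real; congr uexp.
by case: (gaussC R r / gaussC R q) => a b /=; rewrite mulrN.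
Qed.

Lemma cabs_le_Re_Im (R : realType) (z : R[i]) (d : R) :
  `|complex.Re z| <= d -> `|complex.Im z| <= d -> cabs z <= 2 * d.
Proof.
move=> h1 h2; have d0 : 0 <= d := le_trans (normr_ge0 _) h1.
rewrite -(@ler_pXn2r _ 2)// ?nnegrE ?cabs_ge0 ?mulr_ge0// cabs_sqr.
move: h1 h2; rewrite !ler_norml => /andP[? ?] /andP[? ?]; nra.
Qed.

(* [u - i v] approximates all [r / q] of a cell, up to Gaussian integers. *)
Lemma size_fraction_cell (R : realType) (Q B : R) (J : nat) (S : gaussInt -> set gaussInt)
    (s : seq (gaussInt * gaussInt)) : (0 < J)%N -> 1 <= Q -> 2 * Q / J%:R <= 8^-1 ->
  (forall q, q != 0 -> reduced_residue_system q (S q)) -> uniq s ->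
  (forall p, p \in s -> [/\ p.1 != 0, (gauss_norm p.1)%:~R <= Q ^+ 2,
       exists k : int, gauss_norm p.1 = k ^+ 2 & S p.1 p.2]) ->
  (forall (beta : R[i]) (r : gaussInt -> gaussInt) (s : seq gaussInt), uniq s ->
    (forall q, q \in s -> [/\ q != 0, (gauss_norm q)%:~R <= Q ^+ 2,
       exists k : int, gauss_norm q = k ^+ 2, gauss_coprime (r q) q &
       cabs (beta * gaussC R q - gaussC R (r q)) <= 2 * Q / J%:R]) ->
    (size s)%:R <= B) ->
  forall u v : R, (size [seq p <- s | `[< exists k l : int,
      u <= complex.Re (gaussC R p.2 / gaussC R p.1) - k%:~R < u + J%:R^-1 /\
      v <= - complex.Im (gaussC R p.2 / gaussC R p.1) - l%:~R < v + J%:R^-1 >]])%:R <= B.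
Proof.
move=> J0 Q1 hJ hS us hs hB u v; set t := [seq p <- s | _].
have J0' : 0 < J%:R :> R by rewrite ltr0n.
have Q0 : 0 <= Q := le_trans ler01 Q1.
pose beta : R[i] := (u +i* (- v))%C.
pose near (q r : gaussInt) := cabs (beta * gaussC R q - gaussC R r) <= 2 * Q / J%:R.
have tP p : p \in t -> [/\ p.1 != 0, p \in s & exists2 r, near p.1 r & gauss_cong p.1 p.2 r].
  rewrite mem_filter => /andP[/asboolP[k [l [hk hl]]] ps].
  have [q0 nq _ _] := hs p ps; split=> //.
  have Q00 : gaussC R p.1 != 0 by rewrite gaussC_eq0.
  (* The sign of [l] is that of the second coordinate, a negated imaginary part. Replacing the
     numerator by [p.2 - kap * p.1] keeps its residue class and moves the fraction into the cell. *)
  pose kap := GaussInt k (- l); exists (p.2 - kap * p.1); last first.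
    by exists kap; rewrite opprB addrC subrK.
  rewrite /near gaussCB gaussCM.
  set xi := gaussC R p.2 / gaussC R p.1 in hk hl.
  rewrite (_ : _ - _ = (beta - (xi - gaussC R kap)) * gaussC R p.1); last first.
    by rewrite /xi; field.
  rewrite cabsM (_ : 2 * Q / J%:R = 2 * J%:R^-1 * Q); last by ring.
  apply: ler_pM; rewrite ?cabs_ge0//; last first.
    rewrite -(@ler_pXn2r _ 2)// ?nnegrE ?cabs_ge0//.
    by rewrite cabs_gaussC.
  apply: cabs_le_Re_Im; rewrite ler_norml; move: hk hl; case: (xi) => x1 x2 /=.
    by move=> /andP[? ?] _; apply/andP; split; lra.
  by rewrite intrN => _ /andP[? ?]; apply/andP; split; lra.
(* Two translated numerators of one [q] are both within 1/8 of [beta q], hence equal; the original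
   residues are then congruent, and a reduced system contains only one of each class. *)
have tI : {in t &, injective fst}.
  move=> [q r1] [q' r2] /tP[/= q0 s1 [r1' n1 c1]] /tP[/= _ s2 [r2' n2 c2]] /= qq'.
  rewrite -qq' in s2 n2 c2 *; congr (_, _).
  have e : r1' = r2'.
    apply/eqP; rewrite -subr_eq0; apply/eqP; apply: (@cabs_gauss_lt1 R).
    rewrite gaussCB (_ : _ - _ = (beta * gaussC R q - gaussC R r2') -
      (beta * gaussC R q - gaussC R r1')); last by ring.
    apply: le_lt_trans (cabsB _ _) _; rewrite /near in n1 n2; lra.
  have [_ _ _ /= S1] := hs _ s1; have [_ _ _ /= S2] := hs _ s2.
  have [hC hU] := hS q q0; have [r0 [_ r0U]] := hU r1 (hC _ S1).
  rewrite -(r0U r1); last by split=> //; exact: gauss_cong_refl.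
  apply: r0U; split=> //; apply: gauss_cong_trans c1 _.
  by rewrite e; exact: gauss_cong_sym.
rewrite (size_inj _ tI) ?filter_uniq//.
pose rf q := xget 0 [set r | gauss_coprime r q /\ near q r].
apply: (hB beta rf); first exact: undup_uniq.
move=> q; rewrite mem_undup => /mapP[p pt ->].
have [q0 ps [r nr cr]] := tP p pt; have [_ nq sq Sp] := hs p ps.
have [hC _] := hS p.1 q0.
have [] : [set r | gauss_coprime r p.1 /\ near p.1 r] (rf p.1).
  apply: xgetPex; exists r; split=> //.
  by apply: gauss_cong_coprime cr _; exact: hC.
by move=> ? ?; split.
Qed.

Theorem theorem3 (R : realType) (eps : R) (eps_gt0 : 0 < eps) :
  exists2 C : R, 0 < C &
    forall (Q N : R) (a : gaussInt -> R[i]) (S : gaussInt -> set gaussInt),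
      1 <= Q -> 1 <= N ->
      (forall q, q != 0 -> reduced_residue_system q (S q)) ->
      \sum_(q \in [set q : gaussInt |
                    [/\ q != 0, (gauss_norm q)%:~R <= Q ^+ 2 &
                        exists k : int, gauss_norm q = k ^+ 2]])
        \sum_(r \in S q)
          cabs (\sum_(n \in [set n : gaussInt | (gauss_norm n)%:~R <= N])
                  a n * eC (cTr (gaussC R n * gaussC R r / (2 * gaussC R q))))
            ^+ 2
      <= C * (Q * N) `^ eps *
         (Q ^+ 3 + Q ^+ 2 * Num.sqrt N + Num.sqrt Q * N) *
         \sum_(n \in [set n : gaussInt | (gauss_norm n)%:~R <= N]) cabs (a n) ^+ 2.
Proof.
have [C1 C10 hC1] := size_near_fractions eps_gt0.
have [C2 C20 hC2] := large_sieve R.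
(* [36 * 19 = 2 * 18^2 + 36] adds up the two final estimates, both based on
   [J <= 18 (sqrt N + Q)]. *)
have [c c0 cE] : exists2 c : R, 0 < c & c = 36 * 19 by exists (36 * 19) => //; rewrite mulr_gt0.
exists (C2 * C1 * c); first by rewrite !mulr_gt0.
move=> Q N a S Q1 N1 hS.
have Q0 : 0 < Q := lt_le_trans ltr01 Q1.
have N0 : 0 < N := lt_le_trans ltr01 N1.
pose M := Num.sqrt N.
have M1 : 1 <= M by rewrite -[1]sqrtr1 ler_wsqrtr.
have MN : M ^+ 2 = N by rewrite sqr_sqrtr// ltW.
(* The term [M] makes the square contain the disc, and [8 Q] makes [J >= 16 Q], that is
   [eta <= 1/8]. *)
pose K := (Num.truncn (M + 8 * Q)).+1.
have K1 : M + 8 * Q <= K%:R by apply/ltW/truncnS_gt.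
have K2 : K%:R <= M + 8 * Q + 1.
  by rewrite /K -natr1 lerD2r truncn_le; lra.
have MK : Num.sqrt N <= K%:R by rewrite -/M; lra.
pose J := (K + K).+1.
have JE : J%:R = 2 * K%:R + 1 :> R by rewrite /J -natr1 natrD; ring.
have J0 : (0 < J)%N by [].
have J0' : 0 < J%:R :> R by rewrite ltr0n.
pose eta := 2 * Q / J%:R.
have eta0 : 0 < eta by rewrite divr_gt0// mulr_gt0.
have eta8 : eta <= 8^-1 by rewrite ler_pdivrMr// JE; lra.
pose B := C1 * Q `^ eps * (Num.sqrt Q + Q * eta).
have Qe0 : 0 < Q `^ eps by exact: powR_gt0.
have B0 : 0 < B by rewrite !mulr_gt0// addr_gt0 ?sqrtr_gt0// mulr_gt0.
pose nn (j l : nat) := GaussInt (j%:Z - K%:Z) (l%:Z - K%:Z).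
pose aa (j l : nat) : R[i] := if (gauss_norm (nn j l))%:~R <= N then a (nn j l) else 0.
pose X (p : gaussInt * gaussInt) : R := complex.Re (gaussC R p.2 / gaussC R p.1).
pose Y (p : gaussInt * gaussInt) : R := - complex.Im (gaussC R p.2 / gaussC R p.1).
have sumE q r : cabs (\sum_(n \in [set n : gaussInt | (gauss_norm n)%:~R <= N])
      a n * eC (cTr (gaussC R n * gaussC R r / (2 * gaussC R q)))) =
    cabs (\sum_(j < J) \sum_(l < J) aa j l * uexp (j%:R * X (q, r) + l%:R * Y (q, r))).
  rewrite (fsbig_gauss_disc _ MK).
  (* Translating the frequencies multiplies the sum by a factor of modulus 1. *)
  transitivity (cabs (uexp (- K%:R * X (q, r) - K%:R * Y (q, r)) *
    \sum_(j < J) \sum_(l < J) aa j l * uexp (j%:R * X (q, r) + l%:R * Y (q, r)))); last first.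
    by rewrite cabsM cabs_uexp mul1r.
  congr cabs; rewrite mulr_sumr; apply: eq_bigr => j _; rewrite mulr_sumr; apply: eq_bigr => l _.
  rewrite /= -/(nn j l) /aa; case: ifP => _; last by rewrite mul0r mulr0.
  rewrite phase_uexp -/(X (q, r)) -/(Y (q, r)) mulrCA -uexpD; congr (_ * uexp _).
  by rewrite /= !intrB; ring.
have normE : \sum_(n \in [set n : gaussInt | (gauss_norm n)%:~R <= N]) cabs (a n) ^+ 2 =
    \sum_(j < J) \sum_(l < J) cabs (aa j l) ^+ 2.
  rewrite (fsbig_gauss_disc _ MK); apply: eq_bigr => j _; apply: eq_bigr => l _.
  by rewrite /= /aa -/(nn j l); case: ifP => // _; rewrite cabs0 expr0n.
rewrite normE; set A := \sum_(j < J) _.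
have A0 : 0 <= A by apply: sumr_ge0 => j _; apply: sumr_ge0 => l _; exact: sqr_ge0.
set sq := finite_support _ _ _.
pose sr q := finite_support 0 (S q) (fun r =>
  cabs (\sum_(n \in [set n : gaussInt | (gauss_norm n)%:~R <= N])
      a n * eC (cTr (gaussC R n * gaussC R r / (2 * gaussC R q)))) ^+ 2).
pose s := [seq (q, r) | q <- sq, r <- sr q].
have us : uniq s.
  apply: allpairs_uniq_dep => [|q _|]; [exact: finite_support_uniq..|].
  by move=> [q r] [q' r'] _ _ /= [-> ->].
have hs p : p \in s -> [/\ p.1 != 0, (gauss_norm p.1)%:~R <= Q ^+ 2,
       exists k : int, gauss_norm p.1 = k ^+ 2 & S p.1 p.2].
  move=> /allpairsPdep[q [r [hq hr ->]]].
  by have [h1 h2 h3] := finite_support_sub hq; split=> //; exact: finite_support_sub hr.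
have main : \sum_(p <- s) cabs (\sum_(j < J) \sum_(l < J)
      aa j l * uexp (j%:R * X p + l%:R * Y p)) ^+ 2 <= C2 * J%:R ^+ 2 * B * A.
  apply: (hC2 _ s X Y J B aa J0 B0).
  apply: (size_fraction_cell J0 Q1 eta8 hS us hs) => beta r t ut ht.
  exact: (hC1 beta Q eta r t Q1 eta0 eta8 ut ht).
rewrite (_ : \sum_(q <- sq) _ = \sum_(p <- s) cabs (\sum_(j < J) \sum_(l < J)
      aa j l * uexp (j%:R * X p + l%:R * Y p)) ^+ 2); last first.
  rewrite /s big_allpairs_dep; apply: eq_bigr => q _.
  by rewrite -/(sr q); apply: eq_bigr => r _; rewrite sumE.
apply: le_trans main _; apply: ler_wpM2r => //.
have QN : Q `^ eps <= (Q * N) `^ eps.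
  by apply: ge0_ler_powR; rewrite ?nnegrE ?mulr_ge0 ?(ltW eps_gt0) ?(ltW Q0) ?(ltW N0)// ler_peMr// ltW.
rewrite -/M; pose sQ := Num.sqrt Q; rewrite -/sQ.
have sQ1 : 1 <= sQ by rewrite -[1]sqrtr1 ler_wsqrtr.
have sQQ : sQ ^+ 2 = Q by rewrite sqr_sqrtr// ltW.
have -> : C2 * J%:R ^+ 2 * B = C2 * C1 * Q `^ eps * (J%:R ^+ 2 * sQ + 2 * Q ^+ 2 * J%:R).
  by rewrite /B /eta -/sQ; field; rewrite gt_eqF.
have -> : C2 * C1 * c * (Q * N) `^ eps * (Q ^+ 3 + Q ^+ 2 * M + sQ * N) =
  C2 * C1 * (Q * N) `^ eps * (c * (Q ^+ 3 + Q ^+ 2 * M + sQ * N)) by ring.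
have J18 : J%:R <= 18 * (M + Q) by rewrite JE; lra.
apply: ler_pM; rewrite ?mulr_ge0 ?addr_ge0 ?mulr_ge0 ?sqr_ge0 ?(ltW C10) ?(ltW C20) ?(ltW Qe0) ?(ltW J0')//.
- exact: le_trans ler01 sQ1.
- exact: ltW.
- exact: ltW.
- by apply: ler_wpM2l => //; rewrite mulr_ge0 ?(ltW C10) ?(ltW C20).
have sQle : sQ <= Q by rewrite -sQQ expr2 ler_peMr// (le_trans ler01 sQ1).
have e1 : J%:R ^+ 2 * sQ <= 18 ^+ 2 * 2 * (sQ * N + Q ^+ 3).
  have : J%:R ^+ 2 <= (18 * (M + Q)) ^+ 2 by rewrite lerXn2r ?nnegrE ?(ltW J0')// (le_trans (ltW J0')).
  have e : (18 * (M + Q)) ^+ 2 <= 18 ^+ 2 * 2 * (N + Q ^+ 2).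
    by rewrite -MN; have := sqr_ge0 (M - Q); lra.
  move=> /le_trans/(_ e)/(ler_wpM2r (le_trans ler01 sQ1)) /le_trans; apply.
  have := ler_wpM2l (sqr_ge0 Q) sQle; lra.
have e2 : 2 * Q ^+ 2 * J%:R <= 36 * (Q ^+ 2 * M + Q ^+ 3).
  have := ler_wpM2l (sqr_ge0 Q) J18; lra.
rewrite cE.
have h1 : 0 <= sQ * N by rewrite mulr_ge0 ?(ltW N0)// (le_trans ler01 sQ1).
have h2 : 0 <= Q ^+ 2 * M by rewrite mulr_ge0 ?sqr_ge0// (le_trans ler01 M1).
lra.
Qed.
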